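(* Let $H$ be a subgroup of Thompson's group $F$. Then $H=F$ if and only if the following conditions hold. (1) $[F,F]\subseteq \mathrm{Cl}(H)$. (2) $H[F,F]=F$. (3) There is a function $h\in H$ which fixes a finite dyadic fraction $\alpha\in\mathcal D=\mathbb{Z}[\frac12]\cap(0,1)$ such that the slope $h'(\alpha^-)=1$ and the slope $h'(\alpha^+)=2$.
   Context: Thompson's group $F$ is the group of all piecewise-linear increasing homeomorphisms of $[0,1]$ with finitely many breakpoints, all in $\mathbb{Z}[\frac12]\cap(0,1)$, and all slopes integer powers of $2$. Diagrams. For a finite binary word $u$, $[u]$ is the dyadic interval $[.u,.u1^{\mathbb N}]$ (binary expansions). Each $f\in F$ has a unique reduced pair $(T_+,T_-)$ of finite rooted full binary trees with the same number $n$ of leaves such that, if $u_1,\dots,u_n$ and $v_1,\dots,v_n$ are the leaf addresses ($0$ = left, $1$ = right) from left to right of $T_+$ and $T_-$, then $f$ maps $[u_i]$ linearly onto $[v_i]$ for all $i$ (reduced: for no $i$ are leaves $i,i+1$ the two children of one node in both trees). The reduced diagram $\Delta$ of $f$ is the following directed $2$-complex. Its edges are the nodes of $T_+$ and of $T_-$, the $i$-th leaf of $T_+$ being identified with the $i$-th leaf of $T_-$. It has vertices $0,\dots,n$, and a node whose descendant leaves are the $i$-th through $j$-th is an edge directed from vertex $i-1$ to vertex $j$. For each non-leaf node $e$ of either tree there is a positive cell with top edge $e$, left bottom edge the left child of $e$ and right bottom edge the right child of $e$ (together with its formal inverse, a negative cell). The top edge of $\Delta$ is the root of $T_+$, the bottom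 edge of $\Delta$ is the root of $T_-$. (For the identity, $\Delta$ is a single edge.) Core. Let $H\le F$ be generated by elements with reduced diagrams $\Delta_i$, $i\in\mathcal I$. Identify all top edges and all bottom edges of all $\Delta_i$ into one distinguished edge $p$ (with corresponding identification of endpoints). Then apply foldings as long as possible: whenever two positive cells have the same top edge, identify their left bottom edges, their right bottom edges and the cells; whenever two positive cells have the same left bottom edge and the same right bottom edge, identify their top edges and the cells (identifying edges also identifies their initial vertices and their terminal vertices). The resulting complex (a limit if infinitely many foldings are needed) with distinguished edge $p$ is the core $\mathcal L(H)$; it does not depend on the generating set or on the order of foldings. Closure. $\mathcal L(H)$ accepts a diagram $\Delta$ if there is a map from $\Delta$ to $\mathcal L(H)$ taking vertices to vertices, edges to edges, positive cells to positive cells, preserving initial and terminal vertices of edges and top, left bottom and right bottom edges of cells, and sending both the top and the bottom edge of $\Delta$ to $p$. The closure $\mathrm{Cl}(H)$ is the subgroup of all $f\in F$ whose reduced diagram is accepted by $\mathcal L(H)$. *)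

(* Defs.v *)
From HB Require Import structures.
From Stdlib Require Import Relations.
From mathcomp Require Import all_boot all_order all_algebra.
From mathcomp Require Import ring lra zify.
From mathcomp Require Import mathcomp_extra boolp classical_sets functions.
From mathcomp Require Import set_interval reals topology normedtype.

Set Implicit Arguments.
Unset Strict Implicit.
Unset Printing Implicit Defensive.

Import Order.TTheory GRing.Theory Num.Theory.
Import numFieldNormedType.Exports.

Local Open Scope classical_set_scope.
Local Open Scope ring_scope.
Local Open Scope quotient_scope.

Section ThompsonFunctions.
Variable R : realType.
Implicit Types (x y a b : R) (f g : R -> R).

Definition unit_itv : set R := `[0, 1].

Definition dyadic x : Prop := exists (m : int) (k : nat), x = m%:~R / 2 ^+ k.

Definition inner_dyadic x : Prop := dyadic x /\ 0 < x < 1.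

Definition homeomorphism_of (A : set R) f : Prop :=
  [/\ set_bij A A f, {within A, continuous f} &
      exists2 g, {in A, cancel f g} & {within A, continuous g}].

Definition pow2_piecewise_linear f : Prop :=
  exists2 B : seq R, {in B, forall c, inner_dyadic c} &
    forall a b, 0 <= a -> a < b -> b <= 1 ->
      {in B, forall c, ~~ (a < c < b)} ->
      exists k : int, forall x, a <= x <= b -> f x = f a + 2 ^ k * (x - a).

(* Homeomorphisms of [0, 1] are represented by their extension to R by the
   identity, so that equality of functions is equality of elements of F. *)
Definition thompson_fun f : Prop :=
  [/\ forall x, x \notin unit_itv -> f x = x,
      {in unit_itv &, {homo f : x y / x < y}},
      homeomorphism_of unit_itv f &
      pow2_piecewise_linear f].

Lemma in_unit_itv x : (x \in unit_itv) = (0 <= x <= 1).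
Proof. by apply/idP/idP; rewrite inE /unit_itv /= in_itv. Qed.

Lemma dyadic0 : dyadic 0.
Proof. by exists 0, 0%N; rewrite mul0r. Qed.

Lemma dyadicD x y : dyadic x -> dyadic y -> dyadic (x + y).
Proof.
move=> [m [k ->]] [n [l ->]]; exists (m * 2 ^+ l + n * 2 ^+ k), (k + l)%N.
have h2 j : (2 : R) ^+ j != 0 by rewrite expf_neq0 // pnatr_eq0.
rewrite rmorphD !rmorphM !rmorphXn /= exprD.
by field; rewrite !h2.
Qed.

Lemma dyadicN x : dyadic x -> dyadic (- x).
Proof. by move=> [m [k ->]]; exists (- m), k; rewrite rmorphN mulNr. Qed.

Lemma dyadicMX (k : int) x : dyadic x -> dyadic (2 ^ k * x).
Proof.
have h2 j : (2 : R) ^+ j != 0 by rewrite expf_neq0 // pnatr_eq0.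
move=> [m [l ->]]; case: k => k.
  exists (m * 2 ^+ k), l; rewrite rmorphM rmorphXn /= -exprnP; field; exact: h2.
exists m, (k.+1 + l)%N; rewrite NegzE -exprnN exprD; field.
by rewrite !h2.
Qed.


Lemma within_unit_itv_comp f g : {within unit_itv, continuous f} ->
  {within unit_itv, continuous g} -> {homo g : x / x \in unit_itv} ->
  {within unit_itv, continuous (f \o g)}.
Proof.
move=> /subspace_continuousP cf /subspace_continuousP cg gI.
apply/subspace_continuousP => x Ix A nA.
have Igx : unit_itv (g x) by apply/set_mem/gI/mem_set.
have h2 : nbhs x (fun y => unit_itv y -> unit_itv (g y) -> A (f (g y))).
  exact: (cg x Ix _ (cf _ Igx _ nA)).
apply: (@filterS _ (nbhs x) _ _ _ _ h2) => y hy Iy.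
by apply: hy => //; apply/set_mem/gI/mem_set.
Qed.

Lemma thompson_funI f : thompson_fun f -> {homo f : x / x \in unit_itv}.
Proof. by move=> [_ _ [[fI _ _] _ _] _] x; rewrite !inE; exact: fI. Qed.

Lemma thompson_fun_inv f : thompson_fun f ->
  exists g, [/\ cancel f g, cancel g f, forall x, x \notin unit_itv -> g x = x,
               {homo g : x / x \in unit_itv} &
               {within unit_itv, continuous g}].
Proof.
move=> tf; have fI := thompson_funI tf.
case: tf => fout _ [[_ _ fsurj] _ [g0 fK g0c]] _.
pose g x := if x \in unit_itv then g0 x else x.
have g0I x : x \in unit_itv -> g0 x \in unit_itv /\ f (g0 x) = x.
  by rewrite inE => /fsurj [y /mem_set yI <-]; rewrite fK.
have foutI x : x \notin unit_itv -> f x \notin unit_itv by move=> h; rewrite fout.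
exists g; split.
- move=> x; rewrite /g; case: ifPn => h.
    by apply: fK; apply: contraLR h => h; exact: foutI.
  by rewrite fout //; apply: contra h => h; exact: fI.
- move=> x; rewrite /g; case: ifPn => h; first by case: (g0I x h).
  exact: fout.
- by move=> x h; rewrite /g (negbTE h).
- by move=> x h; rewrite /g h; case: (g0I x h).
- have E : {in unit_itv, g0 =1 g} by move=> x xI; rewrite /g xI.
  exact: subspace_eq_continuous E g0c.
Qed.

Lemma thompson_fun_mono f : thompson_fun f ->
  {in unit_itv &, {mono f : x y / x < y}}.
Proof. by move=> [_ h _ _]; apply: leW_mono_in; exact: le_mono_in. Qed.

Lemma thompson_fun01 f : thompson_fun f -> f 0 = 0 /\ f 1 = 1.
Proof.
move=> tf; have fI := thompson_funI tf; have fm := thompson_fun_mono tf.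
have [g [fK gK _ gI _]] := thompson_fun_inv tf.
have I0 : 0 \in unit_itv by rewrite in_unit_itv lexx ler01.
have I1 : 1 \in unit_itv by rewrite in_unit_itv lexx ler01.
split; apply/eqP; rewrite eq_le.
- have := fI _ I0; rewrite in_unit_itv => /andP[-> _]; rewrite andbT.
  rewrite -[leRHS](gK 0) leNgt fm ?gI // -leNgt.
  by have := gI _ I0; rewrite in_unit_itv => /andP[].
- have := fI _ I1; rewrite in_unit_itv => /andP[_ ->]; rewrite /=.
  rewrite -[leLHS](gK 1) leNgt fm ?gI // -leNgt.
  by have := gI _ I1; rewrite in_unit_itv => /andP[].
Qed.

Lemma last_break (B : seq R) x : 0 < x ->
  exists a, [/\ a = 0 \/ a \in B, 0 <= a, a < x &
                {in B, forall c, ~~ (a < c < x)}].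
Proof.
move=> x0; elim: B => [|c B [a [aB a0 ax aP]]].
  by exists 0; split=> //; left.
case: (boolP (a < c < x)) => [/andP[ac cx]|h].
- exists c; split => //; [by right; rewrite mem_head|exact/ltW/(le_lt_trans a0)|].
  move=> d; rewrite inE => /predU1P[->|dB]; first by rewrite ltxx.
  apply: contra (aP d dB) => /andP[cd ->]; rewrite andbT; exact: lt_trans cd.
- exists a; split => //; first by case: aB => [|aB]; [left|right; rewrite inE aB orbT].
  by move=> d; rewrite inE => /predU1P[->|/aP].
Qed.

Lemma count_lt_break (B : seq R) a x : a \in B -> a < x ->
  (count (fun c => (c < a)%R) B < count (fun c => (c < x)%R) B)%N.
Proof.
move=> aB ax; elim: B aB => //= c B IH; rewrite inE => /predU1P[<-|/IH h].
  rewrite ltxx ax add0n add1n ltnS; apply: sub_count => d /= /lt_trans; exact.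
rewrite -addnS leq_add //; case: ltP => // ca.
by rewrite (lt_trans ca ax).
Qed.

Lemma thompson_fun_dyadic f x : thompson_fun f -> x \in unit_itv ->
  dyadic x <-> dyadic (f x).
Proof.
move=> tf; have [f0 f1] := thompson_fun01 tf; case: (tf) => _ _ _ [B BD fB].
have [n] := ubnP (count (fun c => c < x) B); elim: n x => // n IHn x hn.
rewrite in_unit_itv => /andP[]; rewrite le_eqVlt => /predU1P[<-|x0] x1.
  by rewrite f0.
have [a [aB a0 ax aP]] := last_break B x0.
have Ia : a \in unit_itv by rewrite in_unit_itv a0 (ltW (lt_le_trans ax x1)).
have da : dyadic a by case: aB => [->|/BD[]//]; exact: dyadic0.
have dfa : dyadic (f a).
  case: aB => [->|aB]; first by rewrite f0; exact: dyadic0.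
  have /IHn/(_ Ia)[+ _] : (count (fun c => (c < a)%R) B < n)%N.
    by apply: leq_trans (count_lt_break aB ax) _; rewrite -ltnS.
  exact.
have [k fk] := fB a x a0 ax x1 aP.
have -> : f x = f a + 2 ^ k * (x - a) by apply: fk; rewrite lexx ltW.
split=> [dx|dfx].
  by apply: dyadicD => //; apply/dyadicMX/dyadicD => //; exact: dyadicN.
have -> : x = 2 ^ (- k) * ((f a + 2 ^ k * (x - a)) + - f a) + a.
  rewrite addrAC subrr add0r mulrA -expfzDr ?pnatr_eq0 // addNr expr0z mul1r.
  by rewrite subrK.
by apply: dyadicD => //; apply/dyadicMX/dyadicD => //; exact: dyadicN.
Qed.

Lemma thompson_fun_inner_dyadic f x : thompson_fun f -> x \in unit_itv ->
  inner_dyadic x <-> inner_dyadic (f x).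
Proof.
move=> tf Ix; rewrite /inner_dyadic; have [f0 f1] := thompson_fun01 tf.
have -> : (0 < f x < 1) = (0 < x < 1).
  rewrite -{1}f0 -{1}f1 !(thompson_fun_mono tf) // in_unit_itv lexx ler01 //.
by split=> -[/(thompson_fun_dyadic tf Ix)].
Qed.

Lemma thompson_fun_id : thompson_fun id.
Proof.
split=> //; last first.
  exists [::] => // a b _ _ _ _; exists 0 => x _.
  by rewrite expr0z mul1r addrC subrK.
have cid : {within unit_itv, continuous (@id R)}.
  by apply: continuous_subspaceT => x; exact: cvg_id.
split=> //; last by exists id.
by split=> // x Ix; exists x.
Qed.

Lemma thompson_fun_comp f g :
  thompson_fun f -> thompson_fun g -> thompson_fun (f \o g).
Proof.
move=> tf tg.
have fI := thompson_funI tf; have gI := thompson_funI tg.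
have fm := thompson_fun_mono tf; have gm := thompson_fun_mono tg.
have [f' [fK fK' f'out f'I f'c]] := thompson_fun_inv tf.
have [g' [gK gK' g'out g'I g'c]] := thompson_fun_inv tg.
case: (tf) => fout _ [_ fc _] [B BD fB].
case: (tg) => gout _ [_ gc _] [C CD gC].
split.
- by move=> x xI /=; rewrite gout ?fout.
- by move=> x y xI yI xy /=; rewrite fm ?gm ?gI.
- split; [split| |].
  + by move=> x /mem_set xI; apply/set_mem/fI/gI.
  + by move=> x y _ _ /(can_inj fK)/(can_inj gK).
  + move=> x /mem_set xI; exists (g' (f' x)); first exact/set_mem/g'I/f'I.
    by rewrite /= gK' fK'.
  + exact: within_unit_itv_comp.
  + exists (g' \o f'); last exact: within_unit_itv_comp.
    by move=> x _ /=; rewrite fK gK.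
- have BI c : c \in B -> c \in unit_itv.
    by move/BD => [_ /andP[? ?]]; rewrite in_unit_itv !ltW.
  exists (C ++ map g' B).
    move=> c; rewrite mem_cat => /orP[/CD//|/mapP[b bB ->]].
    apply/(thompson_fun_inner_dyadic tg); first exact/g'I/BI.
    by rewrite gK'; exact: BD.
  move=> a b a0 ab b1 hab.
  have Ia : a \in unit_itv by rewrite in_unit_itv a0 (ltW (lt_le_trans ab b1)).
  have Ib : b \in unit_itv by rewrite in_unit_itv b1 (ltW (le_lt_trans a0 ab)).
  have [k gk] : exists k : int, forall x, a <= x <= b ->
      g x = g a + 2 ^ k * (x - a).
    by apply: gC => // c cC; apply: hab; rewrite mem_cat cC.
  have [ga0 gb1] : 0 <= g a /\ g b <= 1.
    by have := gI _ Ia; have := gI _ Ib; rewrite !in_unit_itv => /andP[_ ->] /andP[->].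
  have gab : g a < g b by rewrite gm.
  have gB : {in B, forall c, ~~ (g a < c < g b)}.
    move=> c cB; have Ic : g' c \in unit_itv by exact/g'I/BI.
    by rewrite -[c]gK' !gm //; apply: hab; rewrite mem_cat (map_f g' cB) orbT.
  have [l fl] := fB _ _ ga0 gab gb1 gB.
  exists (l + k) => x /[dup] axb /andP[ax xb] /=.
  have Ix : x \in unit_itv.
    by rewrite in_unit_itv (le_trans a0 ax) (le_trans xb b1).
  rewrite fl; last by rewrite !leNgt !gm // -!leNgt ax xb.
  by rewrite (gk x axb) addrAC subrr add0r mulrA -expfzDr ?pnatr_eq0.
Qed.

Lemma thompson_fun_can f : thompson_fun f ->
  exists g, [/\ thompson_fun g, cancel f g & cancel g f].
Proof.
move=> tf; have fI := thompson_funI tf; have fm := thompson_fun_mono tf.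
have [g [fK gK gout gI gc]] := thompson_fun_inv tf.
case: (tf) => fout _ [_ fc _] [B BD fB].
have gm x y : x \in unit_itv -> y \in unit_itv -> (g x < g y) = (x < y).
  by move=> Ix Iy; rewrite -[in RHS](gK x) -[in RHS](gK y) fm ?gI.
exists g; split => //; split => //.
- by move=> x y Ix Iy; rewrite gm.
- split; [split| |] => //.
  + by move=> x /mem_set xI; apply/set_mem/gI.
  + by move=> x y _ _ /(can_inj gK).
  + by move=> x /mem_set xI; exists (f x); [exact/set_mem/fI|rewrite fK].
  + by exists f => // x _; rewrite gK.
- have BI c : c \in B -> c \in unit_itv.
    by move/BD => [_ /andP[? ?]]; rewrite in_unit_itv !ltW.
  exists (map f B).
    move=> c /mapP[b bB ->].
    by have [+ _] := thompson_fun_inner_dyadic tf (BI _ bB); apply; exact: BD.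
  move=> a b a0 ab b1 hab.
  have Ia : a \in unit_itv by rewrite in_unit_itv a0 (ltW (lt_le_trans ab b1)).
  have Ib : b \in unit_itv by rewrite in_unit_itv b1 (ltW (le_lt_trans a0 ab)).
  have [ga0 gb1] : 0 <= g a /\ g b <= 1.
    by have := gI _ Ia; have := gI _ Ib; rewrite !in_unit_itv => /andP[_ ->] /andP[->].
  have gab : g a < g b by rewrite gm.
  have gB : {in B, forall c, ~~ (g a < c < g b)}.
    move=> c cB; have Ic : f c \in unit_itv by exact/fI/BI.
    by rewrite -[c]fK !gm //; apply: hab; exact: map_f.
  have [k fk] := fB _ _ ga0 gab gb1 gB.
  exists (- k) => x /andP[ax xb].
  have Ix : x \in unit_itv.
    by rewrite in_unit_itv (le_trans a0 ax) (le_trans xb b1).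
  have := fk (g x); rewrite !leNgt !gm // -!leNgt ax xb => /(_ isT).
  rewrite !gK => E.
  have -> : x - a = 2 ^ k * (g x - g a) by rewrite {1}E addrAC subrr add0r.
  by rewrite mulrA -expfzDr ?pnatr_eq0 // addNr expr0z mul1r addrC subrK.
Qed.

Record thompson := Thompson {
  thompson_val :> R -> R;
  thompson_valP : `[< thompson_fun thompson_val >] }.

End ThompsonFunctions.

HB.instance Definition _ (R : realType) := [isSub for @thompson_val R].
HB.instance Definition _ (R : realType) := [Choice of thompson R by <:].

Section ThompsonGroup.
Variable R : realType.
Implicit Types f g : thompson R.

Lemma thompsonP f : thompson_fun f.
Proof. exact/asboolP/thompson_valP. Qed.

Definition thompson_one : thompson R := Thompson (asboolT (@thompson_fun_id R)).

Definition thompson_mul f g : thompson R :=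
  Thompson (asboolT (thompson_fun_comp (thompsonP f) (thompsonP g))).

Definition thompson_inv f : thompson R :=
  let: exist _ h := cid (thompson_fun_can (thompsonP f)) in
  let: And3 h _ _ := h in Thompson (asboolT h).

Lemma thompson_mulA : associative thompson_mul.
Proof. by move=> f g h; exact: val_inj. Qed.

Lemma thompson_mul1 : left_id thompson_one thompson_mul.
Proof. by move=> f; exact: val_inj. Qed.

Lemma thompson_mulr1 : right_id thompson_one thompson_mul.
Proof. by move=> f; exact: val_inj. Qed.

Lemma thompson_mulV : left_inverse thompson_one thompson_inv thompson_mul.
Proof.
move=> f; apply: val_inj; rewrite /thompson_inv; case: cid => g [? fK gK] /=.
exact/funext.
Qed.

Lemma thompson_mulrV : right_inverse thompson_one thompson_inv thompson_mul.
Proof.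
move=> f; apply: val_inj; rewrite /thompson_inv; case: cid => g [? fK gK] /=.
exact/funext.
Qed.

HB.instance Definition _ := isGroup.Build (thompson R)
  thompson_mulA thompson_mul1 thompson_mulr1 thompson_mulV thompson_mulrV.

End ThompsonGroup.

Definition is_subgroup (G : groupType) (A : set G) : Prop :=
  group_closed [in A].

Lemma is_subgroupP (G : groupType) (A : set G) : is_subgroup A <->
  A 1%g /\ forall x y, A x -> A y -> A (x * y^-1)%g.
Proof.
rewrite /is_subgroup /group_closed /divg_closed inE.
split=> -[A1 AD]; split => // x y.
- by move=> /mem_set Ax /mem_set Ay; apply/set_mem/AD.
- by move=> /set_mem Ax /set_mem Ay; apply/mem_set/AD.
Qed.

Definition commutator_subgroup (G : groupType) : set G :=
  smallest (@is_subgroup G) [set [~ x, y]%g | x in setT & y in setT].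

Arguments commutator_subgroup : clear implicits.

Definition set_mulg (G : groupType) (A B : set G) : set G :=
  [set (x * y)%g | x in A & y in B].

Definition left_slope (R : realType) (f : R -> R) (a s : R) : Prop :=
  (f x - f a) / (x - a) @[x --> a^'-] --> s.

Definition right_slope (R : realType) (f : R -> R) (a s : R) : Prop :=
  (f x - f a) / (x - a) @[x --> a^'+] --> s.

Section Quotient.
Variables (T : Type) (r : relation T).

Definition gen_equiv : rel {classic T} :=
  fun x y => `[< clos_refl_sym_trans T r x y >].

Lemma gen_equiv_refl : reflexive gen_equiv.
Proof. by move=> x; apply/asboolP; exact: rst_refl. Qed.

Lemma gen_equiv_sym : symmetric gen_equiv.
Proof. by move=> x y; apply/asboolP/asboolP; exact: rst_sym. Qed.

Lemma gen_equiv_trans : transitive gen_equiv.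
Proof.
move=> y x z /asboolP xy /asboolP yz; apply/asboolP; exact: rst_trans yz.
Qed.

Canonical gen_equiv_equiv :=
  EquivRel gen_equiv gen_equiv_refl gen_equiv_sym gen_equiv_trans.

Definition quot : Type := {eq_quot gen_equiv}.
Definition cls (x : T) : quot := \pi_{eq_quot gen_equiv} (x : {classic T}).
Definition rep (q : quot) : T := repr (q : {eq_quot gen_equiv}).

Lemma repK : cancel rep cls.
Proof. by move=> q; exact: reprK. Qed.

Lemma clsP x y : cls x = cls y <-> clos_refl_sym_trans T r x y.
Proof. by split=> [/eqmodP/asboolP|h] //; apply/eqmodP/asboolP. Qed.

End Quotient.

(* A directed 2-complex is given by its positive cells only: the negative
   cells are their formal inverses and carry no further information. *)
Record complex := Complex {
  vertex : Type;
  edge : Type;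
  cell : Type;
  ini : edge -> vertex;
  ter : edge -> vertex;
  top : cell -> edge;
  lbot : cell -> edge;
  rbot : cell -> edge }.

Record morphism (K L : complex) := Morphism {
  mapV : vertex K -> vertex L;
  mapE : edge K -> edge L;
  mapC : cell K -> cell L;
  map_ini : forall e, ini (mapE e) = mapV (ini e);
  map_ter : forall e, ter (mapE e) = mapV (ter e);
  map_top : forall c, top (mapC c) = mapE (top c);
  map_lbot : forall c, lbot (mapC c) = mapE (lbot c);
  map_rbot : forall c, rbot (mapC c) = mapE (rbot c) }.

Definition disjoint_union (I : Type) (K : I -> complex) : complex := {|
  vertex := {i : I & vertex (K i)};
  edge := {i : I & edge (K i)};
  cell := {i : I & cell (K i)};
  ini e := existT _ (tag e) (ini (tagged e));
  ter e := existT _ (tag e) (ter (tagged e));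
  top c := existT _ (tag c) (top (tagged c));
  lbot c := existT _ (tag c) (lbot (tagged c));
  rbot c := existT _ (tag c) (rbot (tagged c)) |}.

(* Meaningful when the generated equivalence relations are compatible with the
   structure maps, which are then computed on arbitrary representatives. *)
Definition quot_complex (K : complex) (rV : relation (vertex K))
    (rE : relation (edge K)) (rC : relation (cell K)) : complex := {|
  vertex := quot rV;
  edge := quot rE;
  cell := quot rC;
  ini e := cls rV (ini (rep e));
  ter e := cls rV (ter (rep e));
  top c := cls rE (top (rep c));
  lbot c := cls rE (lbot (rep c));
  rbot c := cls rE (rbot (rep c)) |}.

(* The identifications performed when the edges related by r are identified
   and then foldings are applied as long as possible, possibly infinitely many
   times: the least ones that contain r and are stable under folding. *)
Section Folding.
Variables (K : complex) (r : relation (edge K)).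

Inductive fold_edge : edge K -> edge K -> Prop :=
| fold_base e e' : r e e' -> fold_edge e e'
| fold_refl e : fold_edge e e
| fold_sym e e' : fold_edge e e' -> fold_edge e' e
| fold_trans e e' e'' : fold_edge e e' -> fold_edge e' e'' -> fold_edge e e''
| fold_lbot c c' : fold_edge (top c) (top c') -> fold_edge (lbot c) (lbot c')
| fold_rbot c c' : fold_edge (top c) (top c') -> fold_edge (rbot c) (rbot c')
| fold_top c c' : fold_edge (lbot c) (lbot c') -> fold_edge (rbot c) (rbot c') ->
    fold_edge (top c) (top c').

Definition fold_cell (c c' : cell K) : Prop :=
  fold_edge (top c) (top c') \/
  fold_edge (lbot c) (lbot c') /\ fold_edge (rbot c) (rbot c').

Definition fold_vertex (v v' : vertex K) : Prop :=
  exists e e', fold_edge e e' /\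
    (v = ini e /\ v' = ini e' \/ v = ter e /\ v' = ter e').

Definition folded : complex := quot_complex fold_vertex fold_edge fold_cell.

Definition to_folded_vertex (v : vertex K) : vertex folded := cls fold_vertex v.
Definition to_folded_edge (e : edge K) : edge folded := cls fold_edge e.
Definition to_folded_cell (c : cell K) : cell folded := cls fold_cell c.

Lemma to_folded_edgeP e e' :
  to_folded_edge e = to_folded_edge e' <-> fold_edge e e'.
Proof.
split=> [/clsP h|h]; last exact/clsP/rst_step.
elim: h => [x y|x|x y _|x y z _ xy _] //; first exact: fold_refl.
- exact: fold_sym.
- exact: fold_trans.
Qed.

Lemma rep_folded_edge e : fold_edge (rep (to_folded_edge e)) e.
Proof. by apply/to_folded_edgeP; exact: repK. Qed.

Lemma rep_folded_cell c : fold_edge (top (rep (to_folded_cell c))) (top c).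
Proof.
suff h x y : clos_refl_sym_trans _ fold_cell x y -> fold_edge (top x) (top y).
  by apply/h/clsP; exact: repK.
elim=> {x y} [x y [//|[]]|x|x y _|x y z _ xy _].
- exact: fold_top.
- exact: fold_refl.
- exact: fold_sym.
- exact: fold_trans.
Qed.

Lemma folded_ini e : ini (to_folded_edge e) = to_folded_vertex (ini e).
Proof.
apply/clsP/rst_step; exists (rep (to_folded_edge e)), e.
by split; [exact: rep_folded_edge|left].
Qed.

Lemma folded_ter e : ter (to_folded_edge e) = to_folded_vertex (ter e).
Proof.
apply/clsP/rst_step; exists (rep (to_folded_edge e)), e.
by split; [exact: rep_folded_edge|right].
Qed.

Lemma folded_top c : top (to_folded_cell c) = to_folded_edge (top c).
Proof. by apply/to_folded_edgeP; exact: rep_folded_cell. Qed.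

Lemma folded_lbot c : lbot (to_folded_cell c) = to_folded_edge (lbot c).
Proof. by apply/to_folded_edgeP/fold_lbot; exact: rep_folded_cell. Qed.

Lemma folded_rbot c : rbot (to_folded_cell c) = to_folded_edge (rbot c).
Proof. by apply/to_folded_edgeP/fold_rbot; exact: rep_folded_cell. Qed.

End Folding.

Inductive tree : Type := Leaf | Node of tree & tree.

(* Nodes are encoded by their addresses, with false for 0 and true for 1. *)
Fixpoint leaves (T : tree) : seq (seq bool) :=
  if T is Node l r
  then [seq false :: u | u <- leaves l] ++ [seq true :: u | u <- leaves r]
  else [:: [::]].

Fixpoint inner_nodes (T : tree) : seq (seq bool) :=
  if T is Node l r
  then [::] :: [seq false :: u | u <- inner_nodes l] ++
               [seq true :: u | u <- inner_nodes r]
  else [::].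

Definition nodes (T : tree) : seq (seq bool) := leaves T ++ inner_nodes T.

Lemma root_in_nodes T : [::] \in nodes T.
Proof. by case: T => [|l r] //; rewrite /nodes mem_cat mem_head orbT. Qed.

Lemma inner_in_nodes T u : u \in inner_nodes T -> u \in nodes T.
Proof. by rewrite /nodes mem_cat => ->; rewrite orbT. Qed.

Lemma nodes_node l r b u : (b :: u \in nodes (Node l r)) = (u \in nodes (if b then r else l)).
Proof.
rewrite /nodes /= !mem_cat inE /= !mem_cat.
have inj c : injective (cons c : seq bool -> seq bool) by move=> x y [].
have no c s : (b :: u \in [seq (c :: v) | v <- s]) = (b == c) && (u \in s).
  by apply/mapP/andP => [[v vs [-> ->]]|[/eqP-> us]]; [rewrite eqxx|exists u].
by rewrite !no; case: b {no}; rewrite /= ?orbF.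
Qed.

Lemma child_in_nodes T u b : u \in inner_nodes T -> rcons u b \in nodes T.
Proof.
elim: T u b => [|l IHl r IHr] //= u b; rewrite inE => /predU1P[->|].
  by rewrite nodes_node; case: b; exact: root_in_nodes.
rewrite mem_cat => /orP[] /mapP[v hv ->]; rewrite /= nodes_node.
- exact: IHl.
- exact: IHr.
Qed.

Section TreeComplex.
Variable T : tree.

(* A node whose descendant leaves are the i-th through j-th (counted from 1)
   goes from vertex i - 1 to vertex j. *)
Definition first_vertex (u : seq bool) : nat := find (prefix u) (leaves T).

Definition last_vertex (u : seq bool) : nat :=
  (first_vertex u + count (prefix u) (leaves T))%N.

Lemma first_vertex_lt u : (first_vertex u < (size (leaves T)).+1)%N.
Proof. by rewrite ltnS find_size. Qed.

Lemma last_vertex_lt u : (last_vertex u < (size (leaves T)).+1)%N.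
Proof.
rewrite ltnS /last_vertex /first_vertex; elim: (leaves T) => //= v s IH.
by case: (prefix u v); rewrite ?add0n ?add1n ltnS // count_size.
Qed.

Definition tree_complex : complex := {|
  vertex := 'I_(size (leaves T)).+1;
  edge := {u | u \in nodes T};
  cell := {u | u \in inner_nodes T};
  ini e := Ordinal (first_vertex_lt (sval e));
  ter e := Ordinal (last_vertex_lt (sval e));
  top c := exist _ (sval c) (inner_in_nodes (svalP c));
  lbot c := exist _ (rcons (sval c) false) (child_in_nodes false (svalP c));
  rbot c := exist _ (rcons (sval c) true) (child_in_nodes true (svalP c)) |}.

Definition root : edge tree_complex := exist _ [::] (root_in_nodes T).

End TreeComplex.

Record tree_pair := TreePair {
  tplus : tree;
  tminus : tree;
  size_leaves : size (leaves tminus) = size (leaves tplus) }.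

Section Diagram.
Variable P : tree_pair.

Local Notation Kp := (tree_complex (tplus P)).
Local Notation Km := (tree_complex (tminus P)).

Definition minus_vertex : vertex Km -> vertex Kp :=
  cast_ord (congr1 succn (size_leaves P)).

(* The two trees, with vertices 0, ..., n in common and leaves still apart. *)
Definition two_trees : complex := {|
  vertex := vertex Kp;
  edge := edge Kp + edge Km;
  cell := cell Kp + cell Km;
  ini e := match e with inl u => ini u | inr v => minus_vertex (ini v) end;
  ter e := match e with inl u => ter u | inr v => minus_vertex (ter v) end;
  top c := match c with inl a => inl (top a) | inr b => inr (top b) end;
  lbot c := match c with inl a => inl (lbot a) | inr b => inr (lbot b) end;
  rbot c := match c with inl a => inl (rbot a) | inr b => inr (rbot b) end |}.

Inductive same_leaf : edge two_trees -> edge two_trees -> Prop :=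
| SameLeaf i (u : edge Kp) (v : edge Km) :
    (i < size (leaves (tplus P)))%N ->
    sval u = nth [::] (leaves (tplus P)) i ->
    sval v = nth [::] (leaves (tminus P)) i ->
    same_leaf (inl u) (inr v).

Definition diagram : complex :=
  @quot_complex two_trees (fun _ _ => False) same_leaf (fun _ _ => False).

Definition diagram_edge (e : edge two_trees) : edge diagram := cls same_leaf e.

Definition top_edge : edge diagram := diagram_edge (inl (root (tplus P))).
Definition bottom_edge : edge diagram := diagram_edge (inr (root (tminus P))).

End Diagram.

Lemma leaves_prefix_free T u v :
  u \in leaves T -> v \in leaves T -> prefix u v -> u = v.
Proof.
elim: T u v => [|l IHl r IHr] u v /=; first by rewrite !inE => /eqP-> /eqP->.
rewrite !mem_cat => /orP[]/mapP[a ha ->] /orP[]/mapP[b hb ->] //=.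
- by move=> /IHl->.
- by move=> /IHr->.
Qed.

Lemma leaves_uniq T : uniq (leaves T).
Proof.
elim: T => //= l IHl r IHr; rewrite cat_uniq !map_inj_uniq ?IHl ?IHr ?andbT //=.
- by apply/hasPn => _ /mapP[u _ ->]; apply/mapP => -[].
- by move=> u v [].
- by move=> u v [].
Qed.

Lemma prefix_leafE T i : (i < size (leaves T))%N ->
  {in leaves T, prefix (nth [::] (leaves T) i) =1 pred1 (nth [::] (leaves T) i)}.
Proof.
move=> hi v hv /=; apply/idP/eqP => [h|->]; last exact: prefix_refl.
by apply/esym/(leaves_prefix_free _ hv h); exact: mem_nth.
Qed.

Lemma first_vertex_leaf T i : (i < size (leaves T))%N ->
  first_vertex T (nth [::] (leaves T) i) = i.
Proof.
move=> hi; rewrite /first_vertex (eq_in_find (prefix_leafE hi)).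
by rewrite -[LHS]/(index _ _) index_uniq // leaves_uniq.
Qed.

Lemma last_vertex_leaf T i : (i < size (leaves T))%N ->
  last_vertex T (nth [::] (leaves T) i) = i.+1.
Proof.
move=> hi; rewrite /last_vertex first_vertex_leaf // (eq_in_count (prefix_leafE hi)).
by rewrite count_uniq_mem ?leaves_uniq // mem_nth // addn1.
Qed.

Section DiagramTheory.
Variable P : tree_pair.

Definition diagram_vertex (v : vertex (two_trees P)) : vertex (diagram P) :=
  cls (fun _ _ => False) v.
Definition diagram_cell (c : cell (two_trees P)) : cell (diagram P) :=
  cls (fun _ _ => False) c.

Lemma rep_cls_False (T : Type) (x : T) : rep (cls (fun _ _ => False) x) = x.
Proof.
suff h u v : clos_refl_sym_trans T (fun _ _ => False) u v -> u = v.
  by apply/h/clsP; exact: repK.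
by elim=> // {u v} u v w _ -> _ ->.
Qed.

Lemma same_leaf_ends e e' : same_leaf e e' ->
  ini e = ini e' :> vertex (two_trees P) /\ ter e = ter e' :> vertex (two_trees P).
Proof.
case=> i u v hi hu hv; have hi' : (i < size (leaves (tminus P)))%N.
  by rewrite size_leaves.
split; apply: val_inj; rewrite /= hu hv.
- by rewrite !first_vertex_leaf.
- by rewrite !last_vertex_leaf.
Qed.

Lemma rep_diagram_edge (e : edge (two_trees P)) :
  ini (rep (diagram_edge e)) = ini e /\ ter (rep (diagram_edge e)) = ter e.
Proof.
suff h x y : clos_refl_sym_trans _ (@same_leaf P) x y ->
    ini x = ini y /\ ter x = ter y by apply/h/clsP; exact: repK.
by elim=> {x y} [x y /same_leaf_ends|x|x y _ [-> ->]|x y z _ [-> ->] _ [-> ->]].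
Qed.

Lemma diagram_ini e : ini (diagram_edge e) = diagram_vertex (ini e).
Proof. by congr (cls _ _); case: (rep_diagram_edge e). Qed.

Lemma diagram_ter e : ter (diagram_edge e) = diagram_vertex (ter e).
Proof. by congr (cls _ _); case: (rep_diagram_edge e). Qed.

Lemma diagram_top c : top (diagram_cell c) = diagram_edge (top c).
Proof. by congr (cls _ (top _)); exact: rep_cls_False. Qed.

Lemma diagram_lbot c : lbot (diagram_cell c) = diagram_edge (lbot c).
Proof. by congr (cls _ (lbot _)); exact: rep_cls_False. Qed.

Lemma diagram_rbot c : rbot (diagram_cell c) = diagram_edge (rbot c).
Proof. by congr (cls _ (rbot _)); exact: rep_cls_False. Qed.

End DiagramTheory.

(* The core of the subgroup generated by the elements whose reduced diagrams
   are those of the tree pairs in D. *)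
Section Core.
Variable D : set tree_pair.

(* The diagrams of D together with a single edge (the diagram of the pair of
   trivial trees, with index None), which becomes the distinguished edge. *)
Definition core_diagram (i : option {P | D P}) : tree_pair :=
  if i is Some P then sval P else @TreePair Leaf Leaf erefl.

Definition core_diagrams : complex :=
  disjoint_union (fun i => diagram (core_diagram i)).

Definition base_edge : edge core_diagrams := existT _ None (top_edge _).

Inductive base_ident : edge core_diagrams -> edge core_diagrams -> Prop :=
| BaseTop i : base_ident base_edge (existT _ i (top_edge (core_diagram i)))
| BaseBottom i : base_ident base_edge (existT _ i (bottom_edge (core_diagram i))).

Definition core : complex := folded base_ident.

Definition core_edge : edge core := to_folded_edge base_ident base_edge.

End Core.

Definition accepts (K : complex) (p : edge K) (P : tree_pair) : Prop :=
  exists phi : morphism (diagram P) K,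
    mapE phi (top_edge P) = p /\ mapE phi (bottom_edge P) = p.

Section Closure.
Variable R : realType.

(* The number with binary expansion .u *)
Fixpoint binary (u : seq bool) : R :=
  if u is b :: u' then (b%:R + binary u') / 2 else 0.

(* f maps the dyadic interval [u], of length 2 ^- size u, linearly onto [v]. *)
Definition maps_linearly (f : R -> R) (u v : seq bool) : Prop :=
  forall t, 0 <= t <= 1 ->
    f (binary u + t / 2 ^+ size u) = binary v + t / 2 ^+ size v.

(* Leaves number i and i + 1 (counted from 0) are the children of one node;
   an index out of range gives the address [::], which is no child. *)
Definition caret (T : tree) (i : nat) : Prop :=
  exists u, nth [::] (leaves T) i = rcons u false /\
            nth [::] (leaves T) i.+1 = rcons u true.

Definition reduced_pair_of (f : R -> R) (P : tree_pair) : Prop :=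
  (forall i, (i < size (leaves (tplus P)))%N ->
     maps_linearly f (nth [::] (leaves (tplus P)) i)
                     (nth [::] (leaves (tminus P)) i)) /\
  (forall i, ~ (caret (tplus P) i /\ caret (tminus P) i)).

(* The core depends only on H, not on a generating set of it: H itself is used
   as the generating set. *)
Definition subgroup_diagrams (H : set (thompson R)) : set tree_pair :=
  [set P | exists2 f, H f & reduced_pair_of f P].

Definition Cl (H : set (thompson R)) : set (thompson R) :=
  [set f | exists2 P, reduced_pair_of f P &
             accepts (core_edge (subgroup_diagrams H)) P].

End Closure.

(* Main.v *)
From Stdlib Require Import Relations.
Require Import Defs.
From mathcomp Require Import all_boot all_order all_algebra.
From mathcomp Require Import ring lra zify.
From mathcomp Require Import boolp classical_sets functions set_interval.
From mathcomp Require Import reals topology normedtype realfun.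

(** If [H] is all of [F], the slope condition is witnessed by an explicit
    element (thompson_bump), and the closure condition holds because [H] is
    contained in its closure (sub_closure).  The reduced diagram of an
    element of [H] is one of the diagrams that are glued and folded into the
    core, so it maps to the core; what has to be shown is that every element
    has a reduced tree pair (reduced_pair_exists).

    For the converse, give each edge of the core an address, the binary word
    of any tree node lying over it.  Call two words u and v eventually linked
    when, for all long enough w, some element of [H] maps the dyadic interval
    [uw] linearly onto [vw].  This relation is an equivalence that survives
    every folding (fold_edge_linked).  So an element of the closure of [H]
    agrees with an element of [H] on each piece of some dyadic subdivision of
    the unit interval (closure_piecewise), and this holds for all of [F,F].
    An element f of [F] that is trivial near 0 agrees with the commutator
    f t f^-1 t^-1 on [0,d] whenever t pushes the support of f beyond d, hence
    it is also piecewise in [H] there.  In particular [H] inherits from [F]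
    dense orbits and transitivity on the dyadic fractions.

    It remains to glue the pieces.  Let g in [H] fix a dyadic fraction b.  An
    element of [H] that equals g on [0,b] and is trivial on [b,d] is obtained
    by first making the germ of g at the right of b trivial and then
    conjugating by an element that pushes a right neighbourhood of b beyond d
    (keep_left).  Both corrections must be made by elements of [H] that are
    trivial on [0,b]; such elements are provided as follows.
    - The stabilizer of b in [H] fixes no point of (b,1) (stabilizer_moves).
      The condition H[F,F] = F gives an element a of [H] trivial near 0 and
      moving all points near 1.  Let e be the right end of the initial segment
      fixed by a.  If the stabilizer of e fixed a point of (e,1), a supremum
      canonically attached to e would be fixed by this stabilizer and stay
      below 1; but a conjugate of a belongs to the stabilizer and moves that
      supremum.
    - The elements of [H] trivial on [0,b] fix no point of (b,1) either
      (rigid_moves), because the infimum of their fixed points would be fixed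
      by the stabilizer of b.
    - One of them has slope 2 at the right of b (rigid_germ): take the element
      of the slope condition, moved to b, and cancel its action far to the
      left of b by a conjugate of its inverse.

    With gluing, [H] agrees on [0,d], for every d < 1, with each element of
    [F] that is trivial near 0 (agrees_below).  Hence the elements of [H]
    trivial near 1 are normalized by the compactly supported elements of [F],
    and Higman's argument puts all commutators of compactly supported elements
    into [H] (commutator_compact_in).  An element of [F] can be replaced by a
    compactly supported one when conjugating a compactly supported element, so
    modulo such commutators the compactly supported elements are central;
    together with H[F,F] = F this puts every commutator of [F] into [H]
    (commutator_in), and [H = H[F,F] = F]. *)

Set Implicit Arguments.
Unset Strict Implicit.
Unset Printing Implicit Defensive.

Import Order.TTheory GRing.Theory Num.Theory.
Import numFieldNormedType.Exports.

Local Open Scope classical_set_scope.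
Local Open Scope ring_scope.

(** * Piecewise linear functions *)

Section PiecewiseLinear.
Variable R : realType.
Implicit Types (x y z t a b c d : R) (f g : R -> R).

Lemma pow2_gt0 (k : int) : 0 < (2 : R) ^ k.
Proof. by rewrite exprz_gt0. Qed.

Lemma pow2_neq0 (k : int) : (2 : R) ^ k != 0.
Proof. by rewrite gt_eqF ?pow2_gt0. Qed.

Lemma pow2_inj : injective (fun k : int => (2 : R) ^ k).
Proof.
move=> k l /= E; apply: (@ieexprIz R 2) => //.
by rewrite eq_sym lt_eqF // ltr1n.
Qed.

Lemma dyadicB x y : dyadic x -> dyadic y -> dyadic (x - y).
Proof. by move=> dx /dyadicN; exact: dyadicD. Qed.

Lemma dyadic_pow2 (k : int) : dyadic ((2 : R) ^ k).
Proof.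
rewrite -[_ ^ _]mulr1; apply: dyadicMX.
by exists 1, 0%N; rewrite expr0 divr1.
Qed.

Lemma dyadic1 : dyadic (1 : R).
Proof. by rewrite -(expr0z 2); exact: dyadic_pow2. Qed.

(** Dyadic break points, but arbitrary values: unlike [pow2_piecewise_linear]
    this makes sense on any interval, so functions can be assembled piece by
    piece. *)
Definition pl_on f a b : Prop :=
  exists2 B : seq R, {in B, forall c, dyadic c} &
    forall x y, a <= x -> x < y -> y <= b -> {in B, forall c, ~~ (x < c < y)} ->
      exists k : int, forall t, x <= t <= y -> f t = f x + 2 ^ k * (t - x).

(** Additive properties of intervals need to be checked only between
    consecutive break points; induction on the list of break points makes any
    order of them acceptable. *)
Lemma break_ind (B : seq R) a b (Q : R -> R -> Prop) :
  (forall x y, a <= x -> x < y -> y <= b ->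
     {in B, forall c, ~~ (x < c < y)} -> Q x y) ->
  (forall x y z, a <= x -> x < y -> y < z -> z <= b -> Q x y -> Q y z -> Q x z) ->
  forall x y, a <= x -> x < y -> y <= b -> Q x y.
Proof.
move=> + Qtrans; elim: B => [|c B IH] QB; first by move=> x y ax xy yb; exact: QB.
apply: IH => x y ax xy yb nB.
case: (boolP (x < c < y)) => [/andP[xc cy]|nc]; last first.
  by apply: QB => // d; rewrite inE => /predU1P[->|/nB].
apply: (Qtrans _ c) => //; apply: QB => //.
- exact/ltW/(lt_le_trans cy).
- move=> d; rewrite inE => /predU1P[->|/nB]; first by rewrite ltxx andbF.
  by apply: contra => /andP[-> /lt_trans->].
- exact/ltW/(le_lt_trans ax).
- move=> d; rewrite inE => /predU1P[->|/nB]; first by rewrite ltxx.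
  by apply: contra => /andP[/(lt_trans xc)-> ->].
Qed.

Lemma pl_incr f a b x y : pl_on f a b -> a <= x -> x < y -> y <= b -> f x < f y.
Proof.
move=> [B _ fB]; move: x y.
apply: (@break_ind B) => [x y ax xy yb nB|x y z _ _ _ _]; last exact: lt_trans.
have [k /(_ y)->] := fB x y ax xy yb nB; last by rewrite lexx ltW.
by rewrite ltrDl mulr_gt0 ?pow2_gt0 ?subr_gt0.
Qed.

Lemma pl_surj f a b x y z : pl_on f a b -> a <= x -> x < y -> y <= b ->
  f x <= z <= f y -> exists2 t, x <= t <= y & f t = z.
Proof.
move=> [B _ fB] ax xy yb; move: z.
apply: (@break_ind B a b (fun x y => forall z, f x <= z <= f y ->
  exists2 t, x <= t <= y & f t = z)) ax xy yb => {x y}.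
- move=> x y ax xy yb nB z /andP[xz zy].
  have [k fk] := fB x y ax xy yb nB.
  have k0 := pow2_gt0 k.
  have fy : f y = f x + 2 ^ k * (y - x) by apply: fk; rewrite lexx ltW.
  have h : x <= x + (z - f x) / 2 ^ k <= y.
    rewrite lerDl divr_ge0 ?subr_ge0 ?(ltW k0) //=.
    by rewrite -lerBrDl ler_pdivrMr // mulrC lerBlDl -fy.
  exists (x + (z - f x) / 2 ^ k) => //; rewrite fk //.
  by field; rewrite pow2_neq0.
- move=> x y z _ xy yz _ hxy hyz w /andP[xw wz].
  case: (leP w (f y)) => wy.
    have [|t /andP[xt ty] <-] := hxy w; first by rewrite xw.
    by exists t => //; rewrite xt (le_trans ty) // ltW.
  have [|t /andP[yt tz] <-] := hyz w; first by rewrite (ltW wy).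
  by exists t => //; rewrite tz (le_trans _ yt) // ltW.
Qed.

Lemma pl_affine f a b (k : int) u v :
  (forall t, a <= t <= b -> f t = u + 2 ^ k * (t - v)) -> pl_on f a b.
Proof.
move=> fE; exists [::] => // x y ax xy yb _; exists k => t /andP[xt ty].
rewrite (fE t) ?(fE x); first ring.
- by rewrite ax (le_trans (ltW xy)).
- by rewrite (le_trans ax) // (le_trans ty).
Qed.

Lemma pl_eq f g a b : (forall t, a <= t <= b -> f t = g t) ->
  pl_on g a b -> pl_on f a b.
Proof.
move=> fg [B BD gB]; exists B => // x y ax xy yb nB.
have [k gk] := gB x y ax xy yb nB; exists k => t /andP[xt ty].
rewrite (fg t) ?(le_trans ax) ?(le_trans ty) // (fg x) ?ax ?(le_trans (ltW xy)) //.
by apply: gk; rewrite xt.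
Qed.

Lemma pl_cat f a b c : dyadic b -> pl_on f a b -> pl_on f b c -> pl_on f a c.
Proof.
move=> db [B BD fB] [C CD fC]; exists (b :: B ++ C).
  by move=> x; rewrite inE mem_cat => /predU1P[->//|/orP[/BD|/CD]].
move=> x y ax xy yc h; have := h b; rewrite mem_head => /(_ isT).
rewrite negb_and -!leNgt => /orP[bx|yb].
- by apply: fC => // e eC; apply: h; rewrite inE mem_cat eC !orbT.
- by apply: fB => // e eB; apply: h; rewrite inE mem_cat eB orbT.
Qed.

Lemma pl_sub f a b a' b' : a <= a' -> b' <= b -> pl_on f a b -> pl_on f a' b'.
Proof.
move=> aa bb [B BD fB]; exists B => // x y ax xy yb.
by apply: fB => //; [exact: le_trans ax|exact: le_trans bb].
Qed.

Definition paste f b g : R -> R := fun t => if t <= b then f t else g t.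

Lemma pasteL f g b t : t <= b -> paste f b g t = f t.
Proof. by rewrite /paste => ->. Qed.

Lemma pasteR f g b t : f b = g b -> b <= t -> paste f b g t = g t.
Proof.
by move=> fg bt; rewrite /paste; case: (leP t b) => // tb; rewrite (@le_anti _ _ t b) ?tb.
Qed.

Lemma pl_paste f g a b c : dyadic b -> f b = g b ->
  pl_on f a b -> pl_on g b c -> pl_on (paste f b g) a c.
Proof.
move=> db fg pf pg; apply: (pl_cat db).
- by apply: pl_eq pf => t /andP[_]; exact: pasteL.
- by apply: pl_eq pg => t /andP[bt _]; exact: pasteR.
Qed.

Lemma next_break (B : seq R) a x : a < x ->
  exists y, [/\ a < y, y <= x & {in B, forall c, ~~ (a < c < y)}].
Proof.
move=> ax; elim: B => [|c B [y [ay yx h]]]; first by exists x.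
case: (boolP (a < c < y)) => [/andP[ac cy]|nc].
- exists c; split => //; first exact/ltW/(lt_le_trans cy).
  move=> e; rewrite inE => /predU1P[->|/h]; first by rewrite ltxx andbF.
  by apply: contra => /andP[-> /lt_trans->].
- by exists y; split=> // e; rewrite inE => /predU1P[->|/h].
Qed.

Lemma prev_break (B : seq R) x b : x < b ->
  exists y, [/\ x <= y, y < b & {in B, forall c, ~~ (y < c < b)}].
Proof.
move=> ax; elim: B => [|c B [y [ay yx h]]]; first by exists x.
case: (boolP (y < c < b)) => [/andP[ac cy]|nc].
- exists c; split => //; first exact/ltW/(le_lt_trans ay).
  move=> e; rewrite inE => /predU1P[->|/h]; first by rewrite ltxx.
  by apply: contra => /andP[/(lt_trans ac)-> ->].
- by exists y; split=> // e; rewrite inE => /predU1P[->|/h].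
Qed.

(** The side is chosen by [s]: right of [a] for [s = 1], left of [a] for [s =
    -1]. Both sides then share the same calculus. *)
Definition germ s f a (k : int) : Prop :=
  exists2 e, 0 < e & forall t, 0 <= t <= e -> f (a + s * t) = f a + s * 2 ^ k * t.

Lemma pl_germR f a b x : pl_on f a b -> a <= x -> x < b -> exists k, germ 1 f x k.
Proof.
move=> [B _ fB] ax xb; have [y [xy yb nB]] := next_break B xb.
have [k fk] := fB x y ax xy yb nB; exists k; exists (y - x); first by rewrite subr_gt0.
move=> t /andP[t0 ty]; rewrite !mul1r fk; first by congr (_ + _ * _); ring.
by rewrite lerDl t0 -lerBrDl.
Qed.

Lemma pl_germL f a b x : pl_on f a b -> a < x -> x <= b -> exists k, germ (-1) f x k.
Proof.
move=> [B _ fB] ax xb; have [y [ay yx nB]] := prev_break B ax.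
have [k fk] := fB y x ay yx xb nB; exists k; exists (x - y); first by rewrite subr_gt0.
move=> t /andP[t0 ty].
rewrite (fk (_ + _)) ?(fk x); first by ring.
- by rewrite lexx andbT ltW.
- by apply/andP; split; lra.
Qed.

Lemma germ_comp s f g a k l : germ s f (g a) k -> germ s g a l ->
  germ s (f \o g) a (k + l).
Proof.
move=> [e e0 he] [e' e'0 he']; have l0 := pow2_gt0 l.
exists (Num.min e' (e / 2 ^ l)); first by rewrite lt_min e'0 divr_gt0.
move=> t; rewrite le_min => /andP[t0 /andP[te' te]] /=.
rewrite he' ?t0 // -mulrA he; last first.
  by rewrite mulr_ge0 ?(ltW l0) //= mulrC -ler_pdivlMr.
by rewrite expfzDr ?pnatr_eq0 //; ring.
Qed.

Lemma germ_id s a : germ s id a 0.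
Proof. by exists 1 => // t _; rewrite expr0z mulr1. Qed.

Lemma germ_ext s f g a k e : 0 < e ->
  (forall t, 0 <= t <= e -> f (a + s * t) = g (a + s * t)) ->
  germ s f a k -> germ s g a k.
Proof.
move=> e0 fg [e' e'0 he']; exists (Num.min e e'); first by rewrite lt_min e0.
move=> t; rewrite le_min => /and3P[t0 te te'].
rewrite -(fg t) ?t0 // (he' t) ?t0 //; congr (_ + _).
by have := fg 0; rewrite mulr0 addr0 lexx ltW // => /(_ isT).
Qed.

End PiecewiseLinear.

(** * Dyadic intervals are PL-equivalent *)

Section Dyadic.
Variable R : realType.
Implicit Types (x y z t a b c d : R).

Lemma dyadic_dense x y : x < y -> exists2 z, dyadic z & x < z < y.
Proof.
move=> xy; pose N := Num.bound (1 / (y - x)).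
have h : 1 < (y - x) * 2 ^+ N.
  rewrite mulrC -ltr_pdivrMr ?subr_gt0 //.
  have := archi_boundP (ltW (divr_gt0 ltr01 (_ : 0 < y - x))).
  rewrite subr_gt0 => /(_ xy) /lt_trans; apply.
  by rewrite -natrX ltr_nat ltn_expl.
have p0 : (0 : R) < 2 ^+ N by rewrite exprn_gt0.
exists ((Num.floor (x * 2 ^+ N) + 1)%:~R / 2 ^+ N).
  by exists (Num.floor (x * 2 ^+ N) + 1), N.
rewrite ltr_pdivlMr // ltr_pdivrMr // floorD1_gt /=.
apply: (@le_lt_trans _ _ (x * 2 ^+ N + 1)); last by lra.
by rewrite intrD lerD2r floor_le_tmp.
Qed.

Lemma dyadic_common x y : dyadic x -> dyadic y ->
  exists (m n : int) K, x = m%:~R / 2 ^+ K /\ y = n%:~R / 2 ^+ K.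
Proof.
have h2 j : (2 : R) ^+ j != 0 by rewrite expf_neq0 // pnatr_eq0.
move=> [m [k ->]] [n [l ->]]; exists (m * 2 ^+ l), (n * 2 ^+ k), (k + l)%N.
by split; rewrite rmorphM rmorphXn /= exprD; field; rewrite !h2.
Qed.

(** Lengths alone matter, because translations by arbitrary amounts are affine
    of slope 1. *)
Definition stretchable l l' : Prop := forall a a', dyadic a ->
  exists f : R -> R, [/\ f a = a', f (a + l) = a' + l' & pl_on f a (a + l)].

Lemma stretchable_pow2 l (k : int) : stretchable l (2 ^ k * l).
Proof.
move=> a a' _; exists (fun t => a' + 2 ^ k * (t - a)); split; [ring|ring|].
by apply: pl_affine => t _.
Qed.

Lemma stretchableD l1 l1' l2 l2' : dyadic l1 -> 0 <= l1 -> 0 <= l2 ->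
  stretchable l1 l1' -> stretchable l2 l2' -> stretchable (l1 + l2) (l1' + l2').
Proof.
move=> d1 p1 p2 s1 s2 a a' da.
have [f [fa fb pf]] := s1 a a' da.
have [g [ga gb pg]] := s2 (a + l1) (a' + l1') (dyadicD da d1).
exists (paste f (a + l1) g); split.
- by rewrite pasteL ?lerDl.
- by rewrite addrA pasteR ?lerDl ?fb // gb addrA.
- by rewrite addrA; apply: pl_paste => //; [exact: dyadicD|rewrite fb].
Qed.

(** Halve the source: the first half covers one unit of the target, and
    doubling the slope turns the rest into the same problem with one unit
    less. *)
Lemma stretchable_natr n l (k : int) : dyadic l -> 0 <= l ->
  stretchable l (2 ^ k * (n.+1%:R * l)).
Proof.
elim: n l k => [|n IH] l k dl l0; first by rewrite mul1r; exact: stretchable_pow2.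
have dl2 : dyadic (l / 2) by rewrite mulrC -(exprN1 2); exact: dyadicMX.
have l20 : 0 <= l / 2 by rewrite divr_ge0.
have e1 : (2 : R) ^ (k + 1) = 2 ^ k * 2 by rewrite expfzDr ?pnatr_eq0 ?expr1z.
have := stretchableD dl2 l20 l20 (stretchable_pow2 (l / 2) (k + 1)) (IH (l / 2) (k + 1) dl2 l20).
rewrite e1; congr stretchable; first by field.
by rewrite -[n.+2%:R]natr1; field.
Qed.

(** Dually, halve the target: one unit of the source covers the first half,
    and the remaining units cover the other half. *)
Lemma stretchable_natl n l (k : int) : dyadic l -> 0 <= l ->
  stretchable (n.+1%:R * l) (2 ^ k * l).
Proof.
move=> dl l0; elim: n k => [|n IH] k; first by rewrite mul1r; exact: stretchable_pow2.
have e1 : (2 : R) ^ (k - 1) = 2 ^ k / 2 by rewrite expfzDr ?pnatr_eq0 // exprN1.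
have h : 0 <= n.+1%:R * l by rewrite mulr_ge0.
have := stretchableD dl l0 h (stretchable_pow2 l (k - 1)) (IH (k - 1)).
rewrite e1; congr stretchable; last by field.
by rewrite -[n.+2%:R]natr1; ring.
Qed.

(** Map one unit onto one unit until one of the two sides has a single unit
    left. *)
Lemma stretchable_nat m n l : dyadic l -> 0 <= l ->
  stretchable (m.+1%:R * l) (n.+1%:R * l).
Proof.
move=> dl l0; elim: m n => [|m IH] [|n].
- by have := @stretchable_natl 0 l 0 dl l0; rewrite expr0z !mul1r.
- by have := @stretchable_natr n.+1 l 0 dl l0; rewrite expr0z !mul1r.
- by have := @stretchable_natl m.+1 l 0 dl l0; rewrite expr0z !mul1r.
- have h : 0 <= m.+1%:R * l by rewrite mulr_ge0.
  have := stretchableD dl l0 h (stretchable_pow2 l 0) (IH n).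
  by rewrite expr0z; congr stretchable; rewrite -[_.+2%:R]natr1; ring.
Qed.

Lemma stretch a b a' b' : dyadic a -> dyadic b -> dyadic a' -> dyadic b' ->
  a < b -> a' < b' -> exists f : R -> R, [/\ f a = a', f b = b' & pl_on f a b].
Proof.
move=> da db da' db' ab ab'.
have [m [n [K [em en]]]] := dyadic_common (dyadicB db da) (dyadicB db' da').
have p0 : (0 : R) < (2 ^+ K)^-1 by rewrite invr_gt0 exprn_gt0.
have dl : dyadic ((2 : R) ^+ K)^-1 by exists 1, K; rewrite mul1r.
have pos (j : int) x y : x < y -> y - x = j%:~R / 2 ^+ K ->
    exists i : nat, y - x = i.+1%:R * (2 ^+ K)^-1.
  rewrite -subr_gt0 => + e; rewrite e pmulr_lgt0 // ltr0z.
  by case: j {e} => // -[//|i] _; exists i.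
have [i ei] := pos _ _ _ ab em; have [j ej] := pos _ _ _ ab' en.
have [f [f1 f2 f3]] := stretchable_nat i j dl (ltW p0) a' da.
by move: f2 f3; rewrite -ei -ej ![_ + (_ - _)]addrC !subrK => f2 f3; exists f.
Qed.

End Dyadic.

(** * Elements of F as automorphisms of the ordered line *)

Section ThompsonBasics.
Variable R : realType.
Implicit Types (x y z t a b c d : R) (f g h : thompson R).

Lemma thompson_mulE f g t : (f * g)%g t = f (g t).
Proof. by []. Qed.

Lemma thompson_invK f : cancel f (f^-1)%g.
Proof. by move=> t; rewrite -thompson_mulE mulVg. Qed.

Lemma thompson_Kinv f : cancel (f^-1)%g f.
Proof. by move=> t; rewrite -thompson_mulE mulgV. Qed.

Lemma thompson_ext f g : f =1 g -> f = g.
Proof. by move=> fg; apply: val_inj; apply/funext. Qed.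

Lemma thompson0 f : f 0 = 0.
Proof. by have [] := thompson_fun01 (thompsonP f). Qed.

Lemma thompson1 f : f 1 = 1.
Proof. by have [] := thompson_fun01 (thompsonP f). Qed.

Lemma thompson_le0 f t : t <= 0 -> f t = t.
Proof.
rewrite le_eqVlt => /predU1P[->|t0]; first exact: thompson0.
by have [+ _ _ _] := thompsonP f; apply; rewrite in_unit_itv negb_and -!ltNge t0.
Qed.

Lemma thompson_ge1 f t : 1 <= t -> f t = t.
Proof.
rewrite le_eqVlt => /predU1P[<-|t1]; first exact: thompson1.
by have [+ _ _ _] := thompsonP f; apply; rewrite in_unit_itv negb_and -!ltNge t1 orbT.
Qed.

Lemma thompson_ltW f x y : x < y -> f x < f y.
Proof.
have fm := thompson_fun_mono (thompsonP f).
have fm' u v : 0 <= u -> u < v -> v <= 1 -> f u < f v.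
  by move=> u0 uv v1; rewrite fm // in_unit_itv ?u0 ?v1 ?andbT;
    [exact/ltW/(lt_le_trans uv)|exact/(le_trans u0)/ltW].
move=> xy; have [x0|x0] := leP 0 x; last first.
  rewrite (@thompson_le0 f x) ?ltW //; have [y0|y0] := leP y 0.
    by rewrite (@thompson_le0 f y).
  apply: (lt_trans x0); have [y1|y1] := leP y 1; last by rewrite thompson_ge1 ?ltW.
  by rewrite -(thompson0 f) fm'.
have [y1|y1] := leP y 1; first exact: fm'.
rewrite (@thompson_ge1 f y) ?ltW //; have [x1|x1] := leP 1 x.
  by rewrite thompson_ge1.
by apply: lt_trans y1; rewrite -(thompson1 f) fm'.
Qed.

Lemma thompson_lt f : {mono f : x y / x < y}.
Proof.
move=> x y; apply/idP/idP; last exact: thompson_ltW.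
by move/(thompson_ltW (f^-1)%g); rewrite !thompson_invK.
Qed.

Lemma thompson_le f : {mono f : x y / x <= y}.
Proof. by move=> x y; rewrite !leNgt thompson_lt. Qed.

Lemma thompson_dyadic f x : dyadic x -> dyadic (f x).
Proof.
case: (leP 0 x) => x0; last by rewrite thompson_le0 // ltW.
case: (leP x 1) => x1; last by rewrite thompson_ge1 // ltW.
have xI : x \in @unit_itv R by rewrite in_unit_itv x0.
by case: (thompson_fun_dyadic (thompsonP f) xI) => + _; apply.
Qed.

Lemma thompson_gt0 f x : (0 < f x) = (0 < x).
Proof. by rewrite -{1}(thompson0 f) thompson_lt. Qed.

Lemma thompson_lt1 f x : (f x < 1) = (x < 1).
Proof. by rewrite -{1}(thompson1 f) thompson_lt. Qed.

Lemma thompson_inner_dyadic f x : inner_dyadic x -> inner_dyadic (f x).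
Proof.
by move=> [/(thompson_dyadic f) dfx]; rewrite /inner_dyadic thompson_gt0 thompson_lt1.
Qed.

Lemma thompson_pl f : pl_on f 0 1.
Proof.
have [_ _ _ [B BD fB]] := thompsonP f; exists B; first by move=> c /BD[].
by move=> x y x0 xy y1 nB; exact: fB.
Qed.

Lemma thompson_germR f x : 0 <= x -> x < 1 -> exists k, germ 1 f x k.
Proof. exact: pl_germR (thompson_pl f). Qed.

Lemma thompson_germL f x : 0 < x -> x <= 1 -> exists k, germ (-1) f x k.
Proof. exact: pl_germL (thompson_pl f). Qed.

(** Monotonicity and surjectivity are additive over break points; they imply
    continuity of the function and of its inverse. *)
Lemma thompson_of_pl (f : R -> R) : pl_on f 0 1 -> f 0 = 0 -> f 1 = 1 ->
  exists g, forall t, 0 <= t <= 1 -> g t = f t.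
Proof.
move=> pf f0 f1.
pose g t := if t \in @unit_itv R then f t else t.
have gE t : 0 <= t <= 1 -> g t = f t by rewrite /g -in_unit_itv => ->.
have gout t : t \notin @unit_itv R -> g t = t by rewrite /g => /negbTE->.
have glt x y : 0 <= x -> x < y -> y <= 1 -> g x < g y.
  move=> x0 xy y1; rewrite (gE x) ?x0 ?(le_trans (ltW xy)) //.
  by rewrite (gE y) ?y1 ?(le_trans x0 (ltW xy)) // (pl_incr pf x0 xy y1).
have gmono : {in @unit_itv R &, {mono g : x y / x < y}}.
  apply: leW_mono_in; apply: le_mono_in => x y.
  by rewrite !in_unit_itv => /andP[x0 _] /andP[_ y1] xy; exact: glt.
have g0 : g 0 = 0 by rewrite gE ?lexx ?ler01.
have g1 : g 1 = 1 by rewrite gE ?lexx ?ler01.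
have gI t : t \in @unit_itv R -> g t \in @unit_itv R.
  rewrite !in_unit_itv => /andP[t0 t1]; apply/andP; split.
    move: t0; rewrite le_eqVlt => /predU1P[<-|t0]; first by rewrite g0.
    by rewrite -g0 ltW // glt.
  move: t1; rewrite le_eqVlt => /predU1P[->|t1]; first by rewrite g1.
  by rewrite -g1 ltW // glt.
have gsurj z : z \in @unit_itv R -> exists2 t, t \in @unit_itv R & g t = z.
  rewrite in_unit_itv => zI.
  have [|t tI <-] := pl_surj pf (lexx 0) ltr01 (lexx 1) (z := z); first by rewrite f0 f1.
  by exists t; rewrite ?in_unit_itv // gE.
have gleP : {in `[0, 1] &, {mono g : x y / x <= y}}.
  move=> x y xI yI; rewrite !leNgt gmono //;
    by rewrite inE.
have /choice[k gk] : forall z, exists w, z \in @unit_itv R -> w \in @unit_itv R /\ g w = z.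
  move=> z; case: (boolP (z \in @unit_itv R)) => [/gsurj[t tI tz]|_].
    by exists t.
  by exists 0.
have kK : {in @unit_itv R, cancel g k}.
  move=> x xI; have [kI ke] := gk _ (gI _ xI).
  apply/eqP; rewrite eq_le !leNgt -(gmono _ _ xI kI) -(gmono _ _ kI xI).
  by rewrite ke ltxx.
have inv x : x \in `[0, 1]%R -> x \in @unit_itv R by rewrite inE.
have cg : {within @unit_itv R, continuous g}.
  apply: segment_inc_surj_continuous => //; rewrite g0 g1 => z zI.
  have [|t tI tz] := gsurj z; first exact/mem_set.
  by exists t => //; apply/set_mem.
have k0 : k 0 = 0 by rewrite -[in LHS]g0 kK // in_unit_itv lexx ler01.
have k1 : k 1 = 1 by rewrite -[in LHS]g1 kK // in_unit_itv lexx ler01.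
have ck : {within @unit_itv R, continuous k}.
  apply: segment_inc_surj_continuous.
    move=> x y /inv xI /inv yI; have [kx gx] := gk _ xI; have [ky gy] := gk _ yI.
    by rewrite -[in RHS]gx -[in RHS]gy !leNgt gmono.
  rewrite k0 k1 => z /mem_set zI; exists (g z); last by rewrite kK.
  exact/set_mem/gI.
have tg : thompson_fun g.
  split => //.
  - by move=> x y xI yI xy; rewrite gmono.
  - split => //; last by exists k.
    split => //.
    + by move=> x /mem_set xI; apply/set_mem/gI.
    + by move=> x y xI yI /(congr1 k); rewrite !kK.
    + by move=> z /mem_set/gsurj[t tI <-]; exists t => //; apply/set_mem.
  - have [B BD fB] := pf; exists [seq c <- B | 0 < c < 1].
      by move=> c; rewrite mem_filter => /andP[c01 /BD].
    move=> a b a0 ab b1 nB; have [|k' fk] := fB a b a0 ab b1.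
      move=> c cB; case: (boolP (0 < c < 1)) => [c01|nc].
        by apply: nB; rewrite mem_filter c01.
      apply: contra nc => /andP[ac cb].
      by rewrite (le_lt_trans a0 ac) (lt_le_trans cb b1).
    exists k' => x /andP[ax xb].
    rewrite (gE x) ?(le_trans a0 ax) ?(le_trans xb b1) //.
    by rewrite (gE a) ?a0 ?(le_trans (ltW ab)) //; apply: fk; rewrite ax.
by exists (Thompson (asboolT tg)).
Qed.

End ThompsonBasics.

(** * Supports and germs *)

Section Supports.
Variable R : realType.
Implicit Types (x y z t a b c d : R) (f g h : thompson R).

Definition fixes f (A : set R) : Prop := forall t, A t -> f t = t.

Definition fixes_below f x : Prop := fixes f [set t | t <= x].
Definition fixes_above f x : Prop := fixes f [set t | x <= t].

Definition compactly_supported f : Prop :=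
  exists c d, [/\ 0 < c, d < 1, fixes_below f c & fixes_above f d].

Lemma fixesM f g A : fixes f A -> fixes g A -> fixes (f * g)%g A.
Proof. by move=> fA gA t At; rewrite thompson_mulE gA ?fA. Qed.

Lemma fixesV f A : fixes f A -> fixes f^-1%g A.
Proof. by move=> fA t At; rewrite -{1}(fA t At) thompson_invK. Qed.

Lemma fixesJ f g A B : (forall t, B t -> A ((g^-1)%g t)) ->
  fixes f A -> fixes (g * f * g^-1)%g B.
Proof.
by move=> BA fA t Bt; rewrite !thompson_mulE fA ?thompson_Kinv //; exact: BA.
Qed.

Lemma fixes_sub f (A B : set R) : B `<=` A -> fixes f A -> fixes f B.
Proof. by move=> BA fA t /BA/fA. Qed.

Lemma fixes_belowW f x y : y <= x -> fixes_below f x -> fixes_below f y.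
Proof. by move=> yx; apply: fixes_sub => t /= /le_trans; apply. Qed.

Lemma fixes_aboveW f x y : x <= y -> fixes_above f x -> fixes_above f y.
Proof. by move=> xy; apply: fixes_sub => t /=; exact: le_trans. Qed.

Lemma fixes_belowJ f g x : fixes_below f x -> fixes_below (g * f * g^-1)%g (g x).
Proof.
by apply: fixesJ => t /= tx; rewrite -(thompson_le g) thompson_Kinv.
Qed.

Lemma fixes_aboveJ f g x : fixes_above f x -> fixes_above (g * f * g^-1)%g (g x).
Proof.
by apply: fixesJ => t /= tx; rewrite -(thompson_le g) thompson_Kinv.
Qed.

Lemma fixed_point_inv f t : f t = t -> (f^-1)%g t = t.
Proof. by move=> ft; rewrite -{1}ft thompson_invK. Qed.

Lemma moved_inner f t : f t <> t -> 0 < t < 1.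
Proof.
move=> ft; apply/andP; split; rewrite ltNge; apply/negP => h; apply: ft.
- exact: thompson_le0.
- exact: thompson_ge1.
Qed.

Lemma germM s f g a k l : g a = a -> germ s f a k -> germ s g a l ->
  germ s (f * g)%g a (k + l).
Proof. by move=> ga kf kg; apply: (@germ_comp _ s f g) => //; rewrite ga. Qed.

Lemma germV s f a k : germ s f a k -> germ s (f^-1)%g (f a) (- k).
Proof.
move=> [e e0 he]; have k0 := pow2_gt0 R k.
exists (2 ^ k * e); first by rewrite mulr_gt0.
move=> t /andP[t0 te]; have kk : (2 : R) ^ (- k) = (2 ^ k)^-1 by rewrite invr_expz.
have h : f a + s * t = f (a + s * (t / 2 ^ k)).
  rewrite he; first by field; rewrite pow2_neq0.
  by rewrite divr_ge0 ?(ltW k0) //= ler_pdivrMr // mulrC.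
by rewrite h !thompson_invK kk; field; rewrite pow2_neq0.
Qed.

Lemma germJ s f g a k l : f a = a -> germ s f a k -> germ s g a l ->
  germ s (g * f * g^-1)%g (g a) k.
Proof.
move=> fa kf kg.
have -> : k = l + k + - l by lia.
apply: (@germ_comp _ s (g * f)%g (g^-1)%g); last exact: germV.
by rewrite thompson_invK; exact: germM.
Qed.

Lemma germ_fixes_below f a : f a = a -> germ 1 f a 0 ->
  exists2 e, 0 < e & forall t, a <= t <= a + e -> f t = t.
Proof.
move=> fa [e e0 he]; exists e => // t /andP[at_ te].
have := he (t - a); rewrite fa expr0z !mul1r (_ : a + (t - a) = t); last ring.
apply.
by rewrite subr_ge0 at_ lerBlDl.
Qed.

Lemma germ_fixes_above f a : f a = a -> germ (-1) f a 0 ->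
  exists2 e, 0 < e & forall t, a - e <= t <= a -> f t = t.
Proof.
move=> fa [e e0 he]; exists e => // t /andP[te ta].
have := he (a - t); rewrite fa expr0z mulr1 mulN1r (_ : a - (a - t) = t); last ring.
apply.
by apply/andP; split; lra.
Qed.

Lemma compactly_supportedP f :
  germ 1 f 0 0 -> germ (-1) f 1 0 -> compactly_supported f.
Proof.
move=> /(germ_fixes_below (thompson0 f))[e e0 he].
move=> /(germ_fixes_above (thompson1 f))[e' e'0 he'].
exists e, (1 - e'); split => //; first by rewrite gtrBl.
- move=> t /= te; have [t0|/ltW t0] := leP 0 t; last exact: thompson_le0.
  by apply: he; rewrite t0 add0r.
- move=> t /= te; have [t0|/ltW t0] := leP t 1; last exact: thompson_ge1.
  by apply: he'; rewrite t0 te.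
Qed.

Lemma compactly_supportedM f g : compactly_supported f -> compactly_supported g ->
  compactly_supported (f * g)%g.
Proof.
move=> [c [d [c0 d1 fc fd]]] [c' [d' [c'0 d'1 gc gd]]].
exists (Num.min c c'), (Num.max d d'); split.
- by rewrite lt_min c0.
- by rewrite gt_max d1.
- by apply: fixesM; [apply: fixes_belowW fc|apply: fixes_belowW gc];
    rewrite ge_min lexx ?orbT.
- by apply: fixesM; [apply: fixes_aboveW fd|apply: fixes_aboveW gd];
    rewrite le_max lexx ?orbT.
Qed.

Lemma compactly_supportedV f : compactly_supported f -> compactly_supported (f^-1)%g.
Proof. by move=> [c [d [? ? ? ?]]]; exists c, d; split=> //; exact: fixesV. Qed.

(** Slopes at a common fixed point multiply, and powers of 2 commute. *)
Lemma commg_germ f g s a : f a = a -> g a = a -> (exists k, germ s f a k) ->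
  (exists k, germ s g a k) -> germ s [~ f, g]%g a 0.
Proof.
move=> fa ga [k kf] [l lg]; have -> : 0 = - k + (- l + (k + l)) by lia.
have kf' := germV kf; have lg' := germV lg; rewrite fa in kf'; rewrite ga in lg'.
have fa' := fixed_point_inv fa; have ga' := fixed_point_inv ga.
rewrite /commg /conjg; apply: germM => //; first by rewrite !thompson_mulE ga fa.
by apply: germM; rewrite ?thompson_mulE ?ga ?fa //; exact: germM.
Qed.

Lemma commg_compactly_supported f g : compactly_supported [~ f, g]%g.
Proof.
apply: compactly_supportedP; apply: commg_germ;
  rewrite ?thompson0 ?thompson1 //.
all: solve [apply: thompson_germR; lra | apply: thompson_germL; lra].
Qed.

Lemma commutator_compactly_supported f :
  commutator_subgroup (thompson R) f -> compactly_supported f.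
Proof.
move=> /(_ [set g | compactly_supported g]); apply; split.
- apply/is_subgroupP; split; first by exists (1 / 2), (1 / 2); split=> //; lra.
  by move=> x y xc yc; apply: compactly_supportedM => //; exact: compactly_supportedV.
- by move=> _ [x _ [y _ <-]]; exact: commg_compactly_supported.
Qed.

Lemma commutator_mem f g : commutator_subgroup (thompson R) [~ f, g]%g.
Proof. by move=> A [_]; apply; exists f => //; exists g. Qed.

End Supports.

(** * Constructing elements of F *)

Section Constructions.
Variable R : realType.
Implicit Types (x y z t a b c d : R) (f g h : thompson R).

(** Fill the gaps on both sides of [c, d] by stretching, and use the identity
    further out. *)
Lemma thompson_extend (g : R -> R) c d : dyadic c -> dyadic d ->
  dyadic (g c) -> dyadic (g d) -> 0 < c -> c < d -> d < 1 -> 0 < g c -> g d < 1 ->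
  pl_on g c d ->
  exists2 f, compactly_supported f & forall t, c <= t <= d -> f t = g t.
Proof.
move=> dc dd dgc dgd c0 cd d1 gc0 gd1 pg.
have /dyadic_dense[c1 dc1 /andP[c10]] : 0 < Num.min c (g c) by rewrite lt_min c0.
rewrite lt_min => /andP[c1c c1gc].
have /dyadic_dense[d2 dd2 /andP[]] : Num.max d (g d) < 1 by rewrite gt_max d1.
rewrite gt_max => /andP[d2d d2gd] d21.
have [s1 [s1a s1b ps1]] := stretch dc1 dc dc1 dgc c1c c1gc.
have [s2 [s2a s2b ps2]] := stretch dd dd2 dgd dd2 d2d d2gd.
(* the identity below c1 and above d2, stretching on both gaps *)
pose F4 := paste s2 d2 id; pose F3 := paste g d F4.
pose F2 := paste s1 c F3; pose F1 := paste id c1 F2.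
have pid a b : pl_on id a b.
  by apply: (@pl_affine _ _ _ _ 0 0 0) => t _; rewrite expr0z; ring.
have v4 : F4 d = g d by rewrite /F4 pasteL ?ltW.
have v3 : F3 c = g c by rewrite /F3 pasteL ?ltW.
have v2 : F2 c1 = c1 by rewrite /F2 pasteL ?ltW.
have p1 : pl_on F1 0 1.
  apply: pl_paste => //; apply: pl_paste => //; first by rewrite v3.
  by apply: pl_paste => //; apply: pl_paste.
have h0 : F1 0 = 0 by rewrite /F1 pasteL ?ltW.
have big t : d2 <= t -> F1 t = t.
  move=> td; have td' := lt_le_trans d2d td; have tc := lt_trans cd td'.
  rewrite /F1 pasteR ?ltW ?(lt_trans c1c) // /F2 pasteR ?v3 ?ltW //.
  by rewrite /F3 pasteR ?v4 ?ltW // /F4 pasteR.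
have h1 : F1 1 = 1 by rewrite big ?ltW.
have [f fE] := thompson_of_pl p1 h0 h1; exists f.
  exists c1, d2; split => // t /= tc.
  - have [t0|/ltW] := leP 0 t; last exact: thompson_le0.
    rewrite fE ?t0 /=; first by rewrite /F1 pasteL.
    by rewrite (le_trans tc) // (le_trans (ltW c1c)) // (le_trans (ltW cd)) // ltW.
  - have [t1|/ltW] := leP t 1; last exact: thompson_ge1.
    rewrite fE ?t1 ?big // andbT.
    by rewrite (le_trans _ tc) // (le_trans (ltW c0)) // (le_trans (ltW cd)) // ltW.
move=> t /andP[ct td].
rewrite fE; last by rewrite (le_trans (ltW c0) ct) (le_trans td (ltW d1)).
rewrite /F1 pasteR ?v2 ?(le_trans (ltW c1c) ct) //.
by rewrite /F2 pasteR ?v3 // /F3 pasteL.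
Qed.

Lemma thompson_two_points c d c' d' :
  dyadic c -> dyadic d -> dyadic c' -> dyadic d' ->
  0 < c -> c < d -> d < 1 -> 0 < c' -> c' < d' -> d' < 1 ->
  exists f, [/\ compactly_supported f, f c = c' & f d = d'].
Proof.
move=> dc dd dc' dd' c0 cd d1 c'0 cd' d'1.
have [g [gc gd pg]] := stretch dc dd dc' dd' cd cd'.
rewrite -gc -gd in dc' dd' c'0 d'1.
have [f fc fg] := thompson_extend dc dd dc' dd' c0 cd d1 c'0 d'1 pg.
by exists f; split => //; rewrite fg ?gc ?gd // lexx ltW.
Qed.

Lemma thompson_truncate g c d : 0 < c -> c < d -> d < 1 ->
  exists2 f, compactly_supported f & forall t, c <= t <= d -> f t = g t.
Proof.
move=> c0 cd d1.
have [c1 dc1 /andP[c10 c1c]] := dyadic_dense c0.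
have [d2 dd2 /andP[dd21 d21]] := dyadic_dense d1.
have cd' : c1 < d2 by rewrite (lt_trans c1c) // (lt_trans cd).
have gc0 : 0 < g c1 by rewrite thompson_gt0.
have gd1 : g d2 < 1 by rewrite thompson_lt1.
have pg := pl_sub (ltW c10) (ltW d21) (thompson_pl g).
have [f cf fg] := thompson_extend dc1 dd2 (thompson_dyadic g dc1)
  (thompson_dyadic g dd2) c10 cd' d21 gc0 gd1 pg.
exists f => // t /andP[ct td]; apply: fg.
by rewrite (le_trans (ltW c1c)) // (le_trans td) // ltW.
Qed.

Lemma thompson_transitive b b' : inner_dyadic b -> inner_dyadic b' ->
  exists2 f, compactly_supported f & f b = b'.
Proof.
move=> [db /andP[b0 b1]] [db' /andP[b'0 b'1]].
have [d dd /andP[bd d1]] := dyadic_dense b1.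
have [d' dd' /andP[bd' d'1]] := dyadic_dense b'1.
by have [f [? ? ?]] := thompson_two_points db dd db' dd' b0 bd d1 b'0 bd' d'1; exists f.
Qed.

Lemma thompson_minimal x a b : 0 < x < 1 -> a < b -> 0 <= a -> b <= 1 ->
  exists2 f, compactly_supported f & a < f x < b.
Proof.
move=> /andP[x0 x1] ab a0 b1.
have [c dc /andP[c0 cx]] := dyadic_dense x0.
have [d dd /andP[xd d1]] := dyadic_dense x1.
have [c' dc' /andP[ac' c'b]] := dyadic_dense ab.
have [d' dd' /andP[cd' d'b]] := dyadic_dense c'b.
have [f [cf fc fd]] := thompson_two_points dc dd dc' dd' c0 (lt_trans cx xd) d1
  (le_lt_trans a0 ac') cd' (lt_le_trans d'b b1).
exists f => //; rewrite (lt_trans ac') /= -?fc ?thompson_lt //.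
by apply: lt_trans d'b; rewrite -fd thompson_lt.
Qed.

(** The commutator is f t f^-1 t^-1, where t pushes the interval on which f
    may act beyond d, so that its second half is trivial on [0, d]. *)
Lemma commutator_agrees f c d : 0 < c -> fixes_below f c -> d < 1 ->
  exists2 g, commutator_subgroup (thompson R) g & forall t, t <= d -> g t = f t.
Proof.
move=> c0 fc d1.
have /dyadic_dense[c2 dc2 /andP[c20]] : 0 < Num.min c 1 by rewrite lt_min c0 /=.
rewrite lt_min => /andP[c2c c21].
have [c1 dc1 /andP[c10 c12]] := dyadic_dense c20.
have /dyadic_dense[d1' dd1 /andP[+ d1'1]] : Num.max d 0 < 1 by rewrite gt_max d1 /=.
rewrite gt_max => /andP[dd1' d1'0].
have [d2 dd2 /andP[d12 d21]] := dyadic_dense d1'1.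
have [tau [_ _ tau2]] := thompson_two_points dc1 dc2 dd1 dd2 c10 c12 c21 d1'0 d12 d21.
exists [~ f^-1, tau^-1]%g; first exact: commutator_mem.
move=> t td; rewrite /commg /conjg !invgK thompson_mulE mulgA.
congr (thompson_val f _).
have h : fixes_below (tau * f^-1 * tau^-1)%g (tau c) by exact/fixes_belowJ/fixesV.
apply: (h t) => /=.
rewrite (le_trans td) // (le_trans (ltW dd1')) // (le_trans (ltW d12)) //.
by rewrite -tau2 thompson_le ltW.
Qed.

(** The supremum of the initial segments fixed by f is a break point, because
    the slopes of f on its two sides differ. *)
Lemma first_moved f c m : 0 < c -> fixes_below f c -> f m <> m ->
  exists e u, [/\ inner_dyadic e, e < u, fixes_below f e &
                 forall t, e < t < u -> f t <> t].
Proof.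
move=> c0 fc fm; have /andP[m0 m1] := moved_inner fm.
pose S := [set t | fixes_below f t].
have Sm t : S t -> t < m.
  by move=> St; rewrite ltNge; apply/negP => /St.
have hS : has_sup S by split; [exists c|exists m => t /Sm/ltW].
pose e := sup S.
have ce : c <= e by apply: sup_upper_bound.
have em : e <= m by apply: sup_le_ub; [exists c|move=> t /Sm/ltW].
have e0 : 0 < e by exact: lt_le_trans ce.
have e1 : e < 1 by exact: le_lt_trans m1.
have below t : t < e -> f t = t.
  move=> te; move: te; rewrite -subr_gt0 => te; have [s Ss] := sup_adherent te hS.
  by rewrite -/e subKr => ts; apply: Ss; exact/ltW.
have [B BD fB] := thompson_pl f.
have [y1 [y10 y1e nB1]] := prev_break B e0.
have [y2 [ey2 y21 nB2]] := next_break B e1.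
have [k fk] := fB _ _ (ltW e0) ey2 y21 nB2.
(* f is affine on a left neighbourhood of e and the identity before e *)
have fe : f e = e.
  have [l fl] := fB _ _ y10 y1e (ltW e1) nB1.
  pose t := (y1 + e) / 2; pose t' := (t + e) / 2.
  have ht : y1 <= t <= e by apply/andP; rewrite /t; split; lra.
  have ht' : y1 <= t' <= e by apply/andP; rewrite /t' /t; split; lra.
  have he : y1 <= e <= e by rewrite lexx ltW.
  have ft : f t = t by apply: below; rewrite /t; lra.
  have ft' : f t' = t' by apply: below; rewrite /t' /t; lra.
  have := fl _ ht; have := fl _ ht'; have := fl _ he; rewrite ft ft'.
  move: (f y1) (f e) => q fe0 -> E1 E2.
  have E3 : 2 ^ l * (t' - t) = 1 * (t' - t) by rewrite mul1r {2}E1 {2}E2; ring.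
  have d0 : t' - t != 0 by rewrite gt_eqF // /t' /t; lra.
  move/(mulIf d0): E3 => l1.
  by move: E1; rewrite l1; lra.
have feb : fixes_below f e.
  by move=> t /=; rewrite le_eqVlt => /predU1P[->|/below].
have k0 : k != 0.
  apply/eqP => k0; suff : S y2 by move/(sup_upper_bound hS); rewrite leNgt ey2.
  move=> t /= ty; have [/feb//|et] := leP t e.
  by rewrite fk ?ty ?ltW // fe k0 expr0z mul1r addrC subrK.
have pk : (2 : R) ^ k != 1.
  by apply: contra k0; rewrite -[X in _ == X](expr0z 2) => /eqP/pow2_inj->.
exists e, y2; split => //.
- split; last by rewrite e0.
  case: (boolP (e \in B)) => [/BD//|eB]; exfalso.
  have [|l fl] := fB y1 y2 y10 (lt_trans y1e ey2) y21.
    move=> b bB; apply/negP => /andP[b1 b2].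
    have [be|eb|be] := ltgtP b e.
    - by have /negP := nB1 b bB; apply; rewrite b1.
    - by have /negP := nB2 b bB; apply; rewrite eb.
    - by rewrite be in bB; rewrite bB in eB.
  have h t : y1 <= t <= y2 -> f t = f e + 2 ^ l * (t - e).
    have he : y1 <= e <= y2 by rewrite !ltW.
    by move=> ht; rewrite (fl t) // (fl e) //; ring.
  have E1 : f ((y1 + e) / 2) = (y1 + e) / 2 by apply: below; lra.
  rewrite h in E1; last by apply/andP; split; lra.
  have E : 2 ^ l * ((y1 + e) / 2 - e) = 1 * ((y1 + e) / 2 - e) by move: E1; rewrite fe; lra.
  have d0 : (y1 + e) / 2 - e != 0 by rewrite lt_eqF //; lra.
  move/(mulIf d0): E => l1.
  have ey : e <= y2 <= y2 by rewrite lexx ltW.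
  have := fk _ ey; rewrite h; last by rewrite lexx ltW // (lt_trans y1e).
  have d1 : y2 - e != 0 by rewrite subr_eq0 gt_eqF.
  by rewrite l1 => /addrI/(mulIf d1)/esym/eqP; apply/negP.
- move=> t /andP[et ty]; rewrite fk ?ltW // fe => E.
  have : 2 ^ k * (t - e) = 1 * (t - e) by move: E; lra.
  have d1 : t - e != 0 by rewrite subr_eq0 gt_eqF.
  by move/(mulIf d1)/eqP; apply/negP.
Qed.

Lemma germ_left_slope (f : R -> R) a k : germ (-1) f a k -> left_slope f a (2 ^ k).
Proof.
move=> [e e0 he]; apply: cvg_near_cst; near=> x.
have xa : x < a by near: x; exact: nbhs_left_lt.
have ex : a - e < x by near: x; apply: nbhs_left_gt; rewrite gtrBl.
have := he (a - x); rewrite (_ : a + -1 * (a - x) = x); last by ring.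
move=> ->; last by apply/andP; split; lra.
by field; rewrite subr_eq0 lt_eqF.
Unshelve. all: by end_near.
Qed.

Lemma germ_right_slope (f : R -> R) a k : germ 1 f a k -> right_slope f a (2 ^ k).
Proof.
move=> [e e0 he]; apply: cvg_near_cst; near=> x.
have xa : a < x by near: x; exact: nbhs_right_gt.
have ex : x < a + e by near: x; apply: nbhs_right_lt; rewrite ltrDl.
have := he (x - a); rewrite (_ : a + 1 * (x - a) = x); last by ring.
move=> ->; last by apply/andP; split; lra.
by field; rewrite subr_eq0 gt_eqF.
Unshelve. all: by end_near.
Qed.

Lemma left_slope_germ f a k : 0 < a -> a <= 1 ->
  left_slope f a (2 ^ k) -> germ (-1) f a k.
Proof.
move=> a0 a1 fk; have [l fl] := thompson_germL f a0 a1.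
suff <- : l = k by [].
by apply: pow2_inj; apply: (cvg_unique _ (germ_left_slope fl) fk); exact: Rhausdorff.
Qed.

Lemma right_slope_germ f a k : 0 <= a -> a < 1 ->
  right_slope f a (2 ^ k) -> germ 1 f a k.
Proof.
move=> a0 a1 fk; have [l fl] := thompson_germR f a0 a1.
suff <- : l = k by [].
by apply: pow2_inj; apply: (cvg_unique _ (germ_right_slope fl) fk); exact: Rhausdorff.
Qed.

(** Slopes 1, 2, 1, 1/2 on the intervals with ends 0, 1/2, 5/8, 3/4, 1. It
    witnesses the slope condition in F and, being fixed-point free near 1,
    also provides through H[F,F] = F the element of H that drives the
    dynamics. *)
Lemma thompson_bump : exists f : thompson R,
  [/\ fixes_below f (1 / 2), germ 1 f (1 / 2) 1 &
      forall t, 3 / 4 <= t < 1 -> f t <> t].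
Proof.
pose g1 : R -> R := fun t => 1 / 2 + 2 * (t - 1 / 2).
pose g2 : R -> R := fun t => 3 / 4 + 1 * (t - 5 / 8).
pose g3 : R -> R := fun t => 7 / 8 + 1 / 2 * (t - 3 / 4).
have pid a b : pl_on (@id R) a b.
  by apply: (@pl_affine _ _ _ _ 0 0 0) => t _; rewrite expr0z; ring.
have pg1 a b : pl_on g1 a b.
  by apply: (@pl_affine _ _ _ _ 1 (1 / 2) (1 / 2)) => t _; rewrite expr1z.
have pg2 a b : pl_on g2 a b.
  by apply: (@pl_affine _ _ _ _ 0 (3 / 4) (5 / 8)) => t _; rewrite expr0z.
have pg3 a b : pl_on g3 a b.
  by apply: (@pl_affine _ _ _ _ (-1) (7 / 8) (3 / 4)) => t _; rewrite /g3 div1r exprN1.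
pose F3 := paste g2 (3 / 4) g3; pose F2 := paste g1 (5 / 8) F3.
pose F1 := paste id (1 / 2) F2.
have dq (n k : nat) : dyadic (n%:R / 2 ^+ k : R) by exists n, k.
have dh : dyadic (1 / 2 : R) by have := dq 1%N 1%N; rewrite expr1.
have d5 : dyadic (5 / 8 : R) by have := dq 5%N 3%N; congr dyadic; field.
have d3 : dyadic (3 / 4 : R) by have := dq 3%N 2%N; congr dyadic; field.
have g12 : g1 (5 / 8) = g2 (5 / 8) by rewrite /g1 /g2; field.
have g23 : g2 (3 / 4) = g3 (3 / 4) by rewrite /g2 /g3; field.
have v3 : F3 (5 / 8) = g1 (5 / 8) by rewrite g12 /F3 pasteL //; lra.
have v2 : F2 (1 / 2) = 1 / 2 by rewrite /F2 pasteL /g1; [ring|lra].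
have p1 : pl_on F1 0 1.
  by apply: pl_paste => //; apply: pl_paste => //; apply: pl_paste.
have high t : 3 / 4 <= t -> F1 t = 7 / 8 + (t - 3 / 4) / 2.
  move=> ht; rewrite /F1 pasteR ?v2 //; last by lra.
  rewrite /F2 pasteR ?v3 //; last by lra.
  by rewrite /F3 pasteR // /g3; ring.
have h0 : F1 0 = 0 by rewrite /F1 pasteL //; lra.
have h1 : F1 1 = 1 by rewrite high; [field|lra].
have [f fE] := thompson_of_pl p1 h0 h1.
exists f; split.
- move=> t /= t2; have [t0|/ltW] := leP 0 t; last exact: thompson_le0.
  by rewrite fE ?t0 /=; [rewrite /F1 pasteL|lra].
- exists (1 / 8) => [|t /andP[t0 t1]]; first by lra.
  rewrite !fE; [|lra|lra].
  rewrite /F1 (@pasteL _ _ _ _ (1 / 2)) // pasteR ?v2 //; last by lra.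
  by rewrite /F2 pasteL /g1 ?expr1z; [ring|lra].
- by move=> t /andP[t0 t1]; rewrite fE ?high //; [lra|apply/andP; split; lra].
Qed.

End Constructions.

(** * Piecewise agreement and orbits *)

Section Groups.
Variable R : realType.
Implicit Types (x y z t a b c d s : R) (f g h : thompson R).

(** Inductive, so that gluing proceeds along the subdivision, one dyadic cut
    at a time. *)
Inductive piecewise_in (H : set (thompson R)) (f : R -> R) : R -> R -> Prop :=
| piecewise_piece a b h : H h -> (forall t, a <= t <= b -> f t = h t) ->
    piecewise_in H f a b
| piecewise_cut a m b : dyadic m -> a < m -> m < b ->
    piecewise_in H f a m -> piecewise_in H f m b -> piecewise_in H f a b.

Lemma piecewise_in_point H f a b x : piecewise_in H f a b -> a <= x <= b ->
  exists2 h, H h & h x = f x.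
Proof.
elim=> {a b} [a b h Hh fh xab|a m b _ am mb _ IH1 _ IH2 /andP[ax xb]].
  by exists h => //; rewrite fh.
by have [xm|/ltW mx] := leP x m; [apply: IH1; rewrite ax|apply: IH2; rewrite mx].
Qed.

Lemma subgroup_1 (G : set (thompson R)) : is_subgroup G -> G 1%g.
Proof. by move/is_subgroupP => []. Qed.

Lemma subgroup_V (G : set (thompson R)) : is_subgroup G ->
  forall g, G g -> G g^-1%g.
Proof. by move/is_subgroupP => [G1 GD] g Gg; rewrite -[g^-1%g]mul1g; exact: GD. Qed.

Lemma subgroup_M (G : set (thompson R)) : is_subgroup G ->
  forall g h, G g -> G h -> G (g * h)%g.
Proof.
move=> sG g h Gg Gh; rewrite -[h]invgK.
by have /is_subgroupP[_] := sG; apply => //; exact: subgroup_V.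
Qed.

Lemma fixed_supP (G : set (thompson R)) (Y : set R) : has_sup Y ->
  (forall g y, G g -> Y y -> Y (g y)) -> (forall g, G g -> G g^-1%g) ->
  forall g, G g -> g (sup Y) = sup Y.
Proof.
move=> hY GY GV.
have h g : G g -> sup Y <= g (sup Y).
  move=> Gg; apply: sup_le_ub; first by case: hY.
  move=> y Yy; rewrite -(thompson_le (g^-1)%g) thompson_invK.
  by apply: sup_upper_bound => //; apply: GY => //; exact: GV.
move=> g Gg; apply/eqP; rewrite eq_le h // andbT.
by rewrite -(thompson_le (g^-1)%g) thompson_invK h //; exact: GV.
Qed.

(** Otherwise the supremum of the orbit is a common fixed point. *)
Lemma orbit_unbounded (G : set (thompson R)) l : is_subgroup G ->
  (forall s, l < s < 1 -> exists2 g, G g & g s <> s) ->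
  forall x y, l < x -> y < 1 -> exists2 g, G g & y < g x.
Proof.
move=> sG moves x y lx y1.
have [x1|x1] := leP 1 x; first by exists 1%g; [exact: subgroup_1|exact: lt_le_trans x1].
apply: contrapT => no.
have bnd g : G g -> g x <= y.
  by move=> Gg; rewrite leNgt; apply/negP => h; apply: no; exists g.
pose Y := [set g x | g in G].
have Yx : Y x by exists 1%g => //; exact: subgroup_1.
have hY : has_sup Y by split; [exists x|exists y => _ [g Gg <-]; exact: bnd].
have [|g Gg] := moves (sup Y).
  rewrite (lt_le_trans lx) /=; last exact: sup_upper_bound.
  by apply: le_lt_trans y1; apply: sup_le_ub; [exists x|move=> _ [g Gg <-]; exact: bnd].
apply; apply: (fixed_supP (G := G)) => //; last exact: subgroup_V.
by move=> k _ Gk [j Gj <-]; exists (k * j)%g => //; exact: subgroup_M.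
Qed.

End Groups.

(** * From local agreement to generation *)

Section Dynamics.
Variables (R : realType) (H : set (thompson R)).
Hypothesis subH : is_subgroup H.
Hypothesis locH : forall f, commutator_subgroup (thompson R) f -> piecewise_in H f 0 1.
Implicit Types (x y z t b c d s : R) (f g h k : thompson R).

Let H1 : H 1%g := subgroup_1 subH.
Let HV g : H g -> H g^-1%g := @subgroup_V _ _ subH g.
Let HM g h : H g -> H h -> H (g * h)%g := @subgroup_M _ _ subH g h.

Lemma conj_mem g h : H g -> H h -> H (g * h * g^-1)%g.
Proof. by move=> Hg Hh; apply: HM; [exact: HM|exact: HV]. Qed.

(** Compactly supported elements need not be in [F,F], but near a given point
    they agree with commutators, hence with elements of H. *)
Lemma agrees_at_point f x : compactly_supported f -> 0 < x < 1 ->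
  exists2 h, H h & h x = f x.
Proof.
move=> [c [_ [c0 _ fc _]]] /andP[x0 x1].
have [g Cg gf] := commutator_agrees c0 fc x1.
by rewrite -gf //; apply: piecewise_in_point (locH Cg) _; rewrite !ltW.
Qed.

Lemma orbits_dense x a b : 0 < x < 1 -> 0 <= a -> a < b -> b <= 1 ->
  exists2 h, H h & a < h x < b.
Proof.
move=> x01 a0 ab b1; have [f cf fx] := thompson_minimal x01 ab a0 b1.
by have [h Hh hx] := agrees_at_point cf x01; exists h => //; rewrite hx.
Qed.

Lemma dyadics_transitive b b' : inner_dyadic b -> inner_dyadic b' ->
  exists2 h, H h & h b = b'.
Proof.
move=> ib ib'; have [f cf fx] := thompson_transitive ib ib'.
by have [h Hh hx] := agrees_at_point cf ib.2; exists h => //; rewrite hx.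
Qed.

(* the element a is supplied by H[F,F] = F, and e is the right end of the
   initial segment that it fixes *)
Variables (a : thompson R) (e u v : R).
Hypotheses (Ha : H a) (ie : inner_dyadic e) (eu : e < u) (ae : fixes_below a e)
  (au : forall t, e < t < u -> a t <> t)
  (v1 : v < 1) (av : forall t, v < t < 1 -> a t <> t).

Definition sweeps b y := forall z, b < z < y -> exists g, [/\ H g, g b = b & g z <> z].

Lemma sweeps_image g b y : H g -> sweeps b y -> sweeps (g b) (g y).
Proof.
move=> Hg sw z /andP[bz zy]; have [|k [Hk kb kz]] := sw (g^-1 z)%g.
  by rewrite -(thompson_lt g) thompson_Kinv bz -(thompson_lt g) thompson_Kinv.
exists (g * k * g^-1)%g; split; first exact: conj_mem.
- by rewrite !thompson_mulE thompson_invK kb.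
- move=> E; apply: kz; apply: (can_inj (thompson_invK g)).
  by rewrite thompson_Kinv.
Qed.

(** Suppose that the stabilizer of some dyadic fraction b fixes a point of (b,
    1); by transitivity this holds at every dyadic fraction. Let Y be the set
    of all y swept from some dyadic fraction at most e. For c <= e the element
    a stabilizes c and moves all points beyond v, so Y is bounded by v. The
    supremum of Y is fixed by the stabilizer of e, and density of orbits
    provides a conjugate of a that contradicts this. *)
Lemma stabilizer_moves b s : inner_dyadic b -> b < s < 1 ->
  exists g, [/\ H g, g b = b & g s <> s].
Proof.
move=> ib /andP[bs s1]; apply: contrapT => no.
(* the contradictory assumption, carried from b to every c *)
have fixs c : inner_dyadic c -> exists2 r, c < r < 1 &
    forall g, H g -> g c = c -> g r = r.
  move=> ic; have [h Hh hb] := dyadics_transitive ib ic.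
  exists (h s); first by rewrite -hb thompson_lt bs thompson_lt1.
  move=> g Hg gc; apply: contrapT => gh; apply: no; exists (h^-1 * g * h)%g; split.
  - by rewrite -{2}[h]invgK; apply: conj_mem => //; exact: HV.
  - by rewrite !thompson_mulE hb gc -hb thompson_invK.
  - rewrite !thompson_mulE => E; apply: gh.
    by rewrite -[LHS](thompson_Kinv h) E.
pose Y := [set y | exists c, [/\ inner_dyadic c, c <= e & sweeps c y]].
have ac c : c <= e -> a c = c by move=> ce; exact: ae.
have Yv y : Y y -> y <= v.
  move=> [c [ic ce sw]]; rewrite leNgt; apply/negP => vy.
  have [r /andP[cr r1] rP] := fixs c ic.
  have [ry|yr] := ltP r y.
    by have [|g [Hg gc]] := sw r; [rewrite cr|apply; exact: rP].
  by apply: (av (t := r)); [rewrite r1 (lt_le_trans vy)|apply: rP; rewrite ?ac].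
have Yu : Y u.
  exists e; split => // z zu; exists a; split => //; first exact: ac.
  exact: au.
have hY : has_sup Y by split; [exists u|exists v].
have us : u <= sup Y by exact: sup_upper_bound.
have sv : sup Y <= v by apply: sup_le_ub; [exists u|].
have e0 : 0 < e by case: ie => _ /andP[].
have sY : forall g, [set g | H g /\ g e = e] g -> g (sup Y) = sup Y.
  apply: fixed_supP => // [g y [Hg ge] [c [ic ce sw]]|g [Hg ge]].
    exists (g c); split; first exact: thompson_inner_dyadic.
      by rewrite -ge thompson_le.
    exact: sweeps_image.
  by split; [exact: HV|exact: fixed_point_inv].
have u1 : u < 1 by rewrite (le_lt_trans us) // (le_lt_trans sv).
have s01 : 0 < sup Y < 1.
  by rewrite (lt_le_trans _ us) ?(lt_trans e0) // (le_lt_trans sv).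
have [g Hg /andP[eg gu]] := orbits_dense s01 (ltW e0) eu (ltW u1).
(* if e <= g e, the image under g^-1 of the interval swept by a from e bounds
   sup Y too high; otherwise a fixes g e, and g^-1 a g stabilizes e *)
have [ge|ge] := leP e (g e).
  have Yg : Y (g^-1 u)%g.
    exists (g^-1 e)%g; split; first exact: thompson_inner_dyadic.
      by rewrite -(thompson_le g) thompson_Kinv.
    apply: sweeps_image; first exact: HV.
    by move=> z zu; exists a; split => //; [exact: ac|exact: au].
  have := sup_upper_bound hY Yg; rewrite -(thompson_le g) thompson_Kinv.
  by rewrite leNgt gu.
have Se : H (g^-1 * a * g)%g /\ (g^-1 * a * g)%g e = e.
  split; first by rewrite -{2}[g]invgK; apply: conj_mem => //; exact: HV.
  by rewrite !thompson_mulE ac ?thompson_invK // ltW.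
have := sY _ Se; rewrite !thompson_mulE => E.
apply: (au (t := g (sup Y))); first by rewrite eg.
by rewrite -[LHS](thompson_Kinv g) E.
Qed.

Definition rigid b : set (thompson R) := [set g | H g /\ fixes_below g b].

Lemma rigid_subgroup b : is_subgroup (rigid b).
Proof.
apply/is_subgroupP; split; first by split.
by move=> x y [Hx xb] [Hy yb]; split; [apply: HM => //; exact: HV|
  apply: fixesM => //; exact: fixesV].
Qed.

(** At e the element a itself keeps the fixed points of the rigid stabilizer
    away from e, so their infimum lies in (e, 1). The stabilizer of e
    normalizes the rigid stabilizer and would fix this infimum. Transitivity
    carries the result to all dyadic fractions. *)
Lemma rigid_moves b s : inner_dyadic b -> b < s < 1 ->
  exists2 g, rigid b g & g s <> s.
Proof.
suff main r : e < r < 1 -> exists2 g, rigid e g & g r <> r.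
  move=> ib /andP[bs s1]; have [h Hh hb] := dyadics_transitive ib ie.
  have [|g [Hg ge] gs] := main (h s); first by rewrite -hb thompson_lt bs thompson_lt1.
  exists (h^-1 * g * h)%g; last first.
    by rewrite !thompson_mulE => E; apply: gs; rewrite -[LHS](thompson_Kinv h) E.
  split; first by rewrite -{2}[h]invgK; apply: conj_mem => //; exact: HV.
  by rewrite -(thompson_invK h b) hb -{2}[h]invgK; exact: fixes_belowJ.
move=> /andP[er r1]; apply: contrapT => no.
pose Z := [set z | e < z /\ forall g, rigid e g -> g z = z].
have Zr : Z r.
  split=> // g rg; apply: contrapT => gr; apply: no; by exists g.
have Zu z : Z z -> u <= z.
  move=> [ez zP]; rewrite leNgt; apply/negP => zu.
  by apply: (au (t := z)); [rewrite ez|apply: zP].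
have ZS g z : H g -> g e = e -> Z z -> Z (g z).
  move=> Hg ge [ez zP]; split; first by rewrite -ge thompson_lt.
  move=> k [Hk ke]; have gE : (g^-1 e)%g = e by exact: fixed_point_inv.
  have := zP (g^-1 * k * g)%g; rewrite !thompson_mulE => E.
  rewrite -[LHS](thompson_Kinv g) E //; split.
    by rewrite -{2}[g]invgK; apply: conj_mem => //; exact: HV.
  by rewrite -{2}[g]invgK -gE; exact: fixes_belowJ.
have hZ : has_inf Z by split; [exists r|exists u].
have uZ : u <= inf Z by apply: lb_le_inf; [exists r|].
have Zr' : inf Z <= r by apply: ge_inf => //; exists u.
have [|g [Hg ge]] := stabilizer_moves (s := inf Z) ie.
  by rewrite (lt_le_trans eu) // (le_lt_trans Zr').
have low k : H k -> k e = e -> k (inf Z) <= inf Z.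
  move=> Hk ke; apply: lb_le_inf; first by exists r.
  move=> z Zz; rewrite -(thompson_le (k^-1)%g) thompson_invK.
  apply: ge_inf; first by exists u.
  by apply: ZS => //; [exact: HV|exact: fixed_point_inv].
apply; apply/eqP; rewrite eq_le low //=.
rewrite -(thompson_le (g^-1)%g) thompson_invK low //; first exact: HV.
exact: fixed_point_inv.
Qed.

Lemma rigid_unbounded b x y : inner_dyadic b -> b < x -> y < 1 ->
  exists2 g, rigid b g & y < g x.
Proof.
move=> ib; apply: orbit_unbounded; first exact: rigid_subgroup.
by move=> s; exact: rigid_moves.
Qed.


(* the element p0 is supplied by the slope condition *)
Variables (p0 : thompson R) (al : R).
Hypotheses (Hp0 : H p0) (ial : inner_dyadic al) (p0al : p0 al = al)
  (p0L : germ (-1) p0 al 0) (p0R : germ 1 p0 al 1).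

(** A conjugate q of [p0] has the wanted germ at b and is trivial on some [x,
    b]. If g is trivial on [0, x] and moves b to the right, then q and g q
    g^-1 agree on [0, x], while the latter is trivial between x and g b. So q
    (g q g^-1)^-1 is trivial on [0, b] with the germ of q at b. *)
Lemma rigid_germ b : inner_dyadic b -> exists2 p, rigid b p & germ 1 p b 1.
Proof.
move=> ib; have [h Hh hb] := dyadics_transitive ial ib.
have [_ /andP[al0 al1]] := ial; have [_ /andP[b0 b1]] := ib.
pose q := (h * p0 * h^-1)%g.
have qb : q b = b by rewrite /q -hb !thompson_mulE thompson_invK p0al.
have qR : germ 1 q b 1.
  by have [k hk] := thompson_germR h (ltW al0) al1; rewrite -hb; exact: germJ hk.
have qL : germ (-1) q b 0.
  by have [k hk] := thompson_germL h al0 (ltW al1); rewrite -hb; exact: germJ hk.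
have Hq : H q by exact: conj_mem.
move: q Hq qb qR qL => q Hq qb qR qL.
have [ep ep0 qE] := germ_fixes_above qb qL.
have /dyadic_dense[x dx /andP[]] : Num.max (b - ep) 0 < b by rewrite gt_max gtrBl ep0.
rewrite gt_max => /andP[bx x0] xb.
have ix : inner_dyadic x by split=> //; rewrite x0 (lt_trans xb).
have [g [Hg gx] gb] : exists2 g, rigid x g & b < g b.
  have [|g [Hg gx] gb] := rigid_moves (s := b) ix; first by rewrite xb.
  have [h1|h1|/esym//] := ltgtP b (g b); first by exists g.
  exists (g^-1)%g; last by rewrite -(thompson_lt g) thompson_Kinv.
  by split; [exact: HV|exact: fixesV].
have qx t : x <= t -> t <= b -> q t = t.
  by move=> xt tb; apply: qE; rewrite tb (le_trans (ltW bx)).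
have big t : x <= t -> t <= g b -> (q * (g * q^-1 * g^-1))%g t = q t.
  move=> xt tb; rewrite !thompson_mulE; congr (thompson_val q _).
  rewrite fixed_point_inv ?thompson_Kinv //; apply: qx.
    by rewrite -(thompson_le g) thompson_Kinv (gx x) //=.
  by rewrite -(thompson_le g) thompson_Kinv.
exists (q * (g * q^-1 * g^-1))%g.
  split; first by apply: HM => //; apply: conj_mem => //; exact: HV.
  move=> t tb; rewrite /= in tb; have [tx|xt] := leP t x; last first.
    have [xt' tg] : x <= t /\ t <= g b by split; apply: ltW => //; exact: le_lt_trans tb gb.
    by rewrite big // qx.
  have gt1 : (g^-1 t)%g = t by apply: fixed_point_inv; exact: gx.
  have qtx : (q^-1 t)%g <= x by rewrite -(thompson_le q) thompson_Kinv qx // ltW.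
  by rewrite !thompson_mulE gt1 (gx _ qtx) thompson_Kinv.
apply: (germ_ext (e := g b - b) _ _ qR); first by rewrite subr_gt0.
move=> t /andP[t0 tg]; rewrite mul1r big //; last by rewrite -lerBrDl.
by rewrite (le_trans (ltW xb)) // lerDl.
Qed.

Lemma rigid_germ_int b (j : int) : inner_dyadic b ->
  exists2 p, rigid b p & germ 1 p b j.
Proof.
move=> ib; have sr := rigid_subgroup b.
have pos n : exists2 p, rigid b p & germ 1 p b n%:Z.
  elim: n => [|n [p rp gp]]; first by exists 1%g; [exact: subgroup_1|exact: germ_id].
  have [q rq gq] := rigid_germ ib; exists (q * p)%g; first exact: subgroup_M.
  by rewrite intS; apply: germM => //; exact: rp.2 b (lexx b).
case: j => n; first exact: pos.
have [p rp gp] := pos n.+1; exists (p^-1)%g; first exact: subgroup_V.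
by rewrite NegzE -{1}(rp.2 b (lexx b)); exact: germV.
Qed.

(** After correction of the germ at b by a rigid element p, the product p g is
    trivial on a right neighbourhood of b; a rigid element r that pushes this
    neighbourhood beyond d conjugates p g to the required element. *)
Lemma keep_left g b d : H g -> inner_dyadic b -> g b = b -> d < 1 ->
  exists k, [/\ H k, forall t, t <= b -> k t = g t & forall t, b <= t <= d -> k t = t].
Proof.
move=> Hg ib gb d1; have [_ /andP[b0 b1]] := ib.
have [j gj] := thompson_germR g (ltW b0) b1.
have [p [Hp pb] pj] := rigid_germ_int (- j) ib.
have pg : germ 1 (p * g)%g b 0 by rewrite -(addNr j); exact: germM.
have gle t : t <= b -> g t <= b by rewrite -{2}gb thompson_le.
have [|ep ep0 pgE] := germ_fixes_below _ pg; first by rewrite thompson_mulE gb pb /=.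
have [|r [Hr rb] rd] := rigid_unbounded ib (x := b + ep) _ d1; first by rewrite ltrDl.
exists (r * (p * g) * r^-1)%g; split.
- by apply: conj_mem => //; exact: HM.
- move=> t tb; rewrite !thompson_mulE (fixed_point_inv (rb t tb)).
  by rewrite (pb _ (gle t tb)) (rb _ (gle t tb)).
- move=> t /andP[bt td]; rewrite 2!thompson_mulE pgE ?thompson_Kinv //.
  rewrite -(thompson_le r) thompson_Kinv (rb b) //= bt /=.
  by rewrite -(thompson_le r) thompson_Kinv (le_trans td) // ltW.
Qed.

(** Divide g by the element of [keep_left]. *)
Lemma keep_right g b d : H g -> inner_dyadic b -> g b = b -> d < 1 ->
  exists k, [/\ H k, forall t, t <= b -> k t = t & forall t, b <= t <= d -> k t = g t].
Proof.
move=> Hg ib gb d1; have [k [Hk kg kd]] := keep_left Hg ib gb d1.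
exists (g * k^-1)%g; split; first by apply: HM => //; exact: HV.
- move=> t tb; rewrite thompson_mulE.
  have -> : (k^-1 t)%g = (g^-1 t)%g; last by rewrite thompson_Kinv.
  apply: (can_inj (thompson_invK k)); rewrite thompson_Kinv kg ?thompson_Kinv //.
  by rewrite -(thompson_le g) thompson_Kinv gb.
- by move=> t td; rewrite thompson_mulE fixed_point_inv // kd.
Qed.

(** At a cut x the elements of H agreeing with f on the two sides differ by an
    element fixing x, whose right half can be applied alone. *)
Lemma extend_agreement f x y : piecewise_in H f x y -> x = 0 \/ inner_dyadic x ->
  y <= 1 -> forall h, H h -> (forall t, t <= x -> h t = f t) ->
  forall d, d < 1 -> d <= y -> exists2 k, H k & forall t, t <= d -> k t = f t.
Proof.
elim=> {x y} [x y h' Hh' fh|x m y dm xm my _ IH1 _ IH2] ix y1 h Hh hf d d1 dy.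
  have [dx|xd] := leP d x.
    by exists h => // t td; apply: hf; exact: le_trans dx.
  have E t : x <= t -> t <= d -> f t = h' t.
    by move=> xt td; apply: fh; rewrite xt (le_trans td).
  case: ix => [x0|ix].
    exists h' => // t td; have [xt|/ltW tx] := leP x t; first by rewrite E.
    by rewrite x0 in tx; rewrite !thompson_le0.
  have gx : (h^-1 * h')%g x = x.
    by rewrite thompson_mulE -(E x (lexx x) (ltW xd)) -(hf x (lexx x)) thompson_invK.
  have [k [Hk kx kd]] := keep_right (HM (HV Hh) Hh') ix gx d1.
  exists (h * k)%g; first exact: HM.
  move=> t td; rewrite thompson_mulE; have [tx|/ltW xt] := leP t x.
    by rewrite kx // hf.
  by rewrite kd ?xt // thompson_mulE thompson_Kinv E.
have m1 : m < 1 by rewrite (lt_le_trans my).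
have im : inner_dyadic m.
  split=> //; rewrite m1 andbT.
  by case: ix => [<-//|[_ /andP[x0 _]]]; exact: lt_trans xm.
have [|h1 Hh1 h1f] := IH1 ix _ h Hh hf m m1 (lexx m); first exact: ltW.
by apply: IH2 Hh1 h1f d d1 dy => //; right.
Qed.

Lemma agrees_below f c d : 0 < c -> fixes_below f c -> d < 1 ->
  exists2 h, H h & forall t, t <= d -> h t = f t.
Proof.
move=> c0 fc d1; have [g Cg gf] := commutator_agrees c0 fc d1.
have h0 t : t <= 0 -> (1%g : thompson R) t = g t by move=> t0; rewrite !thompson_le0.
have [h Hh hg] := extend_agreement (locH Cg) (or_introl erefl) (lexx 1) H1 h0 d1 (ltW d1).
by exists h => // t td; rewrite hg ?gf.
Qed.

Definition tame : set (thompson R) := [set k | H k /\ exists2 d, d < 1 & fixes_above k d].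

Lemma tame_subgroup : is_subgroup tame.
Proof.
apply/is_subgroupP; split; first by split=> //; exists (1 / 2) => //; lra.
move=> g h [Hg [d d1 gd]] [Hh [d' d'1 hd]]; split; first by apply: HM => //; exact: HV.
exists (Num.max d d'); first by rewrite gt_max d1.
apply: fixesM; first by apply: fixes_aboveW gd; rewrite le_max lexx.
by apply: fixesV; apply: fixes_aboveW hd; rewrite le_max lexx orbT.
Qed.

(** On [0, d], where k lives, the element f can be replaced by an element of
    H. *)
Lemma tameJ f k : compactly_supported f -> tame k -> tame (f * k * f^-1)%g.
Proof.
move=> [c [_ [c0 _ fc _]]] [Hk [d d1 kd]]; split; last first.
  by exists (f d); [rewrite thompson_lt1|exact: fixes_aboveJ].
have [h Hh hf] := agrees_below c0 fc d1.
suff -> : (f * k * f^-1 = h * k * h^-1)%g by exact: conj_mem.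
pose w := (h^-1 * f)%g.
have wd t : t <= d -> w t = t.
  by move=> td; rewrite thompson_mulE -hf // thompson_invK.
have wle t : (w t <= d) = (t <= d) by rewrite -{1}(wd d (lexx d)) thompson_le.
have kle t : (k t <= d) = (t <= d) by rewrite -{1}(kd d (lexx d)) thompson_le.
have -> : f = (h * w)%g by rewrite /w mulgA mulgV mul1g.
have wk : (w * k = k * w)%g.
  apply: thompson_ext => t; change (w (k t) = k (w t)); have [td|/ltW dt] := leP t d.
    by rewrite (wd t td) wd ?kle.
  by rewrite (kd t) // (kd (w t)) //= -(wd d (lexx d)) thompson_le.
by rewrite invgM -!mulgA; congr (_ * _)%g; rewrite !mulgA wk mulgK.
Qed.

(** The commutator of a with an element of H that moves e to the right is
    trivial near 1 but acts right after e; dense orbits bring its support to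
    any point. *)
Lemma tame_moves s : 0 < s < 1 -> exists2 k, tame k & k s <> s.
Proof.
move=> s01; have [_ e01] := ie; have /andP[e0 e1] := e01.
have [g Hg /andP[ge g1]] := orbits_dense e01 (ltW e0) e1 (lexx 1).
pose k := (g * a * g^-1 * a^-1)%g.
have Tk : tame k.
  split; first by apply: HM; [exact: conj_mem|exact: HV].
  have [_ [d [_ d1 _ kd]]] := commg_compactly_supported (g^-1)%g (a^-1)%g.
  exists d => //; move: kd; congr (fixes_above _ d).
  by rewrite /commg /conjg !invgK /k !mulgA.
pose w := Num.min u (g e).
have ew : e < w by rewrite lt_min eu.
have kw t : e < t < w -> k (a t) <> a t.
  move=> /andP[et]; rewrite lt_min => /andP[tu tg] E.
  apply: (au (t := t)); first by rewrite et.
  rewrite -E /k !thompson_mulE thompson_invK (ae (t := (g^-1 t)%g)) ?thompson_Kinv //=.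
  by rewrite -(thompson_le g) thompson_Kinv ltW.
have ae0 : 0 <= a e by rewrite ltW // thompson_gt0.
have aew : a e < a w by rewrite thompson_lt.
have aw1 : a w <= 1 by rewrite ltW // thompson_lt1 gt_min g1 orbT.
have [h Hh /andP[hs1 hs2]] := orbits_dense s01 ae0 aew aw1.
exists (h^-1 * k * h)%g.
  split; first by rewrite -{2}[h]invgK; apply: conj_mem; [exact: HV|case: Tk].
  have [_ [d d1 kd]] := Tk; exists (h^-1 d)%g; first by rewrite thompson_lt1.
  by rewrite -{2}[h]invgK; exact: fixes_aboveJ.
rewrite !thompson_mulE => E.
apply: (kw (a^-1 (h s))%g); last by rewrite thompson_Kinv -[LHS](thompson_Kinv h) E.
by rewrite -(thompson_lt a) thompson_Kinv hs1 -(thompson_lt a) thompson_Kinv.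
Qed.

(** Higman's argument: if k moves the support of f off that of g, then f and f
    (k f^-1 k^-1) have the same commutator with g, and the latter element is
    tame because f normalizes tame elements. *)
Lemma commutator_compact_in f g : compactly_supported f -> compactly_supported g ->
  H (f * g * f^-1 * g^-1)%g.
Proof.
move=> cf cg; have [c [d [c0 d1 fc fd]]] := cf; have [c' [d' [c'0 d'1 gc gd]]] := cg.
have [k Tk kcd] : exists2 k, tame k & d' < k c.
  by apply: (orbit_unbounded tame_subgroup) c0 d'1 => s; exact: tame_moves.
have TM := subgroup_M tame_subgroup; have TV := subgroup_V tame_subgroup.
pose z := (k * f^-1 * k^-1)%g.
have zg : (z * g = g * z)%g.
  have zk : fixes_below z (k c) by apply: fixes_belowJ; exact: fixesV.
  have gk : g (k c) = k c by apply: gd => /=; exact: ltW.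
  apply: thompson_ext => t; change (z (g t) = g (z t)); have [tk|/ltW kt] := leP t (k c).
    by rewrite (zk t tk) zk //= -gk thompson_le.
  have kz : k c <= z t by rewrite -(zk (k c) (lexx _)) thompson_le.
  by rewrite (gd t) ?(gd (z t)) //=; apply: le_trans (ltW kcd) _.
have Tx : tame (f * z)%g.
  by rewrite /z !mulgA; apply: TM (TV _ Tk); exact: tameJ.
move: z zg Tx => z zg Tx.
have -> : (f * g * f^-1 * g^-1 = (f * z) * (g * (f * z)^-1 * g^-1))%g.
  by rewrite invgM !mulgA -[(f * z * g)%g]mulgA zg !mulgA mulgK.
by case: (TM _ _ Tx (tameJ cg (TV _ Tx))).
Qed.

(** An element h acts on k by conjugation only through its restriction to the
    support of k, so h can be replaced by a compactly supported element. *)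
Lemma commutator_compact_right g f : compactly_supported f -> H [~ g, f]%g.
Proof.
have main h k : compactly_supported k -> H (h * k * h^-1 * k^-1)%g.
  move=> ck; have [c [d [c0 d1 kc kd]]] := ck.
  pose c' := Num.min c (1 / 4); pose d' := Num.max d (3 / 4).
  have c'0 : 0 < c' by rewrite lt_min c0; lra.
  have d'1 : d' < 1 by rewrite gt_max d1; lra.
  have cd' : c' < d' by rewrite (@lt_trans _ _ (1 / 2)) // ?gt_min ?lt_max; apply/orP; right; lra.
  have kc' : fixes_below k c' by apply: fixes_belowW kc; rewrite ge_min lexx.
  have kd' : fixes_above k d' by apply: fixes_aboveW kd; rewrite le_max lexx.
  have [h' ch' h'E] := thompson_truncate h c'0 cd' d'1.
  pose w := (h'^-1 * h)%g.
  have wE t : c' <= t <= d' -> w t = t.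
    by move=> ht; rewrite thompson_mulE -h'E // thompson_invK.
  have wc : w c' = c' by apply: wE; rewrite lexx ltW.
  have wd : w d' = d' by apply: wE; rewrite lexx ltW.
  have wk : (w * k = k * w)%g.
    apply: thompson_ext => t; change (w (k t) = k (w t)).
    have [tc|/ltW ct] := leP t c'.
      have wt : w t <= c' by rewrite -[leRHS]wc thompson_le.
      by rewrite (kc' t tc) (kc' (w t) wt).
    have [dt|/ltW td] := leP d' t.
      have wt : d' <= w t by rewrite -[leLHS]wd thompson_le.
      by rewrite (kd' t dt) (kd' (w t) wt).
    rewrite (wE t) ?ct // wE // -{1}(kc' c' (lexx _)) -{1}(kd' d' (lexx _)).
    by rewrite !thompson_le ct.
  have -> : (h * k * h^-1 = h' * k * h'^-1)%g.
    have -> : h = (h' * w)%g by rewrite /w mulgA mulgV mul1g.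
    by rewrite invgM -!mulgA; congr (_ * _)%g; rewrite !mulgA wk mulgK.
  exact: commutator_compact_in.
move=> /compactly_supportedV cf; have := main (g^-1)%g _ cf.
by rewrite /commg /conjg !invgK !mulgA.
Qed.

Hypothesis HC : set_mulg H (commutator_subgroup (thompson R)) = setT.

(** Write both entries as products of an element of H and a compactly
    supported one and expand: all factors but the commutator of the H-parts
    involve a compactly supported entry. *)
Lemma commutator_in g h : H [~ g, h]%g.
Proof.
have dec w : exists w1 w2, [/\ H w1, compactly_supported w2 & w = (w1 * w2)%g].
  have : setT w by []. rewrite -HC => -[w1 Hw1 [w2 Cw2 <-]].
  by exists w1, w2; split => //; exact: commutator_compactly_supported.
have HX w f : H w -> compactly_supported f -> H (w ^ f)%g.
  move=> Hw cf; have -> : (w ^ f = w * [~ w, f])%g by rewrite /commg mulVKg.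
  by apply: HM => //; exact: commutator_compact_right.
have [g1 [g2 [Hg1 cg2 ->]]] := dec g.
have E1 : ([~ g1 * g2, h] = [~ g1, h] ^ g2 * [~ g2, h])%g.
  by rewrite /commg /conjg !invgM !mulgA !mulgK.
rewrite E1; apply: HM; last first.
  have -> : [~ g2, h]%g = ([~ h, g2]^-1)%g by rewrite /commg /conjg !invgM !invgK !mulgA.
  by apply/HV/commutator_compact_right.
apply: (HX) => //; have [h1 [h2 [Hh1 ch2 ->]]] := dec h.
have -> : ([~ g1, h1 * h2] = [~ g1, h2] * [~ g1, h1] ^ h2)%g.
  by rewrite /commg /conjg !invgM !mulgA !mulgK.
apply: HM; first exact: commutator_compact_right.
apply: HX => //; rewrite /commg /conjg.
by do !apply: HM => //; exact: HV.
Qed.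

Lemma generation : H = setT.
Proof.
apply/seteqP; split=> // g _; have : setT g by [].
rewrite -HC => -[h Hh [c Cc <-]]; apply: HM => //.
by apply: Cc; split=> // _ [x _ [y _ <-]]; exact: commutator_in.
Qed.

End Dynamics.

(** * Dyadic words *)

Section Words.
Variable R : realType.
Implicit Types (t : R) (u v w : seq bool) (f g h : R -> R).

Lemma pow2n_gt0 n : (0 : R) < 2 ^+ n.
Proof. by rewrite exprn_gt0. Qed.

Lemma pow2n_neq0 n : (2 : R) ^+ n != 0.
Proof. by rewrite gt_eqF ?pow2n_gt0. Qed.

Lemma binary_cat u w : binary R (u ++ w) = binary R u + binary R w / 2 ^+ size u.
Proof.
elim: u => [|b u IH] /=; first by rewrite expr0 divr1 add0r.
by rewrite IH exprS; field; rewrite pow2n_neq0.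
Qed.

Lemma binary_rcons u (b : bool) :
  binary R (rcons u b) = binary R u + b%:R / 2 ^+ (size u).+1.
Proof. by rewrite -cats1 binary_cat /= addr0 exprS; field; rewrite pow2n_neq0. Qed.

Lemma binary_ge0 u : 0 <= binary R u.
Proof. by elim: u => //= b u IH; rewrite divr_ge0 // addr_ge0. Qed.

Lemma binary_le1 u : binary R u + 1 / 2 ^+ size u <= 1.
Proof.
elim: u => [|b u IH] /=; first by rewrite expr0 divr1 add0r.
have -> : (b%:R + binary R u) / 2 + 1 / 2 ^+ (size u).+1 =
    (b%:R + (binary R u + 1 / 2 ^+ size u)) / 2.
  by rewrite exprS; field; rewrite pow2n_neq0.
have hb : (b%:R : R) <= 1 by case: b.
move: (binary R u + _) IH (b%:R : R) hb => q q1 c c1; lra.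
Qed.

Lemma binary_dyadic u : dyadic (binary R u).
Proof.
elim: u => [|b u IH] /=; first exact: dyadic0.
rewrite mulrC -(exprN1 2); apply: dyadicMX; apply: dyadicD => //.
by case: b; [exact: dyadic1|exact: dyadic0].
Qed.

Lemma maps_linearly_cat f u v w : maps_linearly f u v -> maps_linearly f (u ++ w) (v ++ w).
Proof.
move=> fuv t /andP[t0 t1].
have h x : binary R (x ++ w) + t / 2 ^+ size (x ++ w) =
    binary R x + (binary R w + t / 2 ^+ size w) / 2 ^+ size x.
  by rewrite binary_cat size_cat exprD; field; rewrite !pow2n_neq0.
rewrite !h; apply: fuv; rewrite addr_ge0 ?binary_ge0 ?divr_ge0 ?exprn_ge0 //=.
apply: le_trans (binary_le1 w); rewrite lerD2l ler_pM2r ?invr_gt0 ?pow2n_gt0 //.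
Qed.

Lemma maps_linearly_id u : maps_linearly (@id R) u u.
Proof. by []. Qed.

Lemma maps_linearly_comp f g u v w :
  maps_linearly g u v -> maps_linearly f v w -> maps_linearly (f \o g) u w.
Proof. by move=> guv fvw t t01 /=; rewrite guv ?fvw. Qed.

Lemma maps_linearly_can f g u v : cancel f g ->
  maps_linearly f u v -> maps_linearly g v u.
Proof. by move=> fg fuv t t01; rewrite -fuv ?fg. Qed.

Lemma maps_linearly_eq f h u v : maps_linearly f u v -> maps_linearly h u v ->
  forall t, binary R u <= t <= binary R u + 1 / 2 ^+ size u -> f t = h t.
Proof.
move=> fuv huv t /andP[t0 t1].
have -> : t = binary R u + ((t - binary R u) * 2 ^+ size u) / 2 ^+ size u.
  by field; rewrite pow2n_neq0.
rewrite fuv ?huv // mulr_ge0 ?exprn_ge0 ?subr_ge0 //=.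
  by rewrite -ler_pdivlMr ?pow2n_gt0 // lerBlDl.
by rewrite -ler_pdivlMr ?pow2n_gt0 // lerBlDl.
Qed.

End Words.

(** * Addresses of the edges of the core *)

Section CoreAddresses.
Variables (R : realType) (H : set (thompson R)).
Hypothesis subH : is_subgroup H.
Implicit Types (u v w x y : seq bool) (h : thompson R).

Definition linked u v : Prop := exists2 h, H h & maps_linearly h u v.

(** Linking only after a common extension is what survives folding: two edges
    with linked halves are identified, though no single element of H need act
    linearly on both halves. *)
Definition eventually_linked u v : Prop :=
  exists k, forall w, size w = k -> linked (u ++ w) (v ++ w).

Local Notation "u ~~> v" := (eventually_linked u v) (at level 70).

Lemma linked_cat u v w : linked u v -> linked (u ++ w) (v ++ w).
Proof. by move=> [h Hh huv]; exists h => //; exact: maps_linearly_cat. Qed.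

Lemma linked_eventually u v : linked u v -> u ~~> v.
Proof. by move=> uv; exists 0%N => w _; exact: linked_cat. Qed.

Lemma eventually_linkedW u v : u ~~> v ->
  exists k, forall w, (k <= size w)%N -> linked (u ++ w) (v ++ w).
Proof.
move=> [k kP]; exists k => w kw; rewrite -(cat_take_drop k w) !catA.
by apply/linked_cat/kP; rewrite size_take_min; apply/minn_idPl.
Qed.

Lemma elinked_refl u : u ~~> u.
Proof.
by apply: linked_eventually; exists 1%g; [exact: subgroup_1|exact: maps_linearly_id].
Qed.

Lemma elinked_sym u v : u ~~> v -> v ~~> u.
Proof.
move=> [k kP]; exists k => w /kP[h Hh hw]; exists (h^-1)%g; first exact: subgroup_V.
exact: maps_linearly_can (thompson_invK h) hw.
Qed.

Lemma elinked_trans v u w : u ~~> v -> v ~~> w -> u ~~> w.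
Proof.
move=> /eventually_linkedW[k kP] /eventually_linkedW[l lP].
exists (maxn k l) => x sx; have [|h Hh hu] := kP x; first by rewrite sx leq_maxl.
have [|g Hg gv] := lP x; first by rewrite sx leq_maxr.
exists (g * h)%g; first exact: subgroup_M.
exact: maps_linearly_comp hu gv.
Qed.

Lemma elinked_child u v b : u ~~> v -> rcons u b ~~> rcons v b.
Proof.
move=> /eventually_linkedW[k kP]; exists k => w sw; rewrite !cat_rcons.
by apply: kP; rewrite /= sw.
Qed.

Lemma elinked_parent u v : rcons u false ~~> rcons v false ->
  rcons u true ~~> rcons v true -> u ~~> v.
Proof.
move=> /eventually_linkedW[k kP] /eventually_linkedW[l lP].
exists (maxn k l).+1 => -[//|[] w] [sw]; rewrite -!cat_rcons.
- by apply: lP; rewrite sw leq_maxr.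
- by apply: kP; rewrite sw leq_maxl.
Qed.

Local Notation D := (subgroup_diagrams H).

Definition address P (e : edge (two_trees P)) : seq bool :=
  match e with inl u => sval u | inr v => sval v end.

(** The representative is arbitrary; leaves identified in the diagram of an
    element h of H have addresses linked by h, so the address is well defined
    up to eventual linking. *)
Definition diagram_address P (e : edge (diagram P)) : seq bool := address (rep e).

Definition core_diagrams_address (e : edge (core_diagrams D)) : seq bool :=
  diagram_address (tagged e).

Definition core_address (e : edge (core D)) : seq bool :=
  core_diagrams_address (rep e).

Lemma same_leaf_linked (i : option {P | D P}) e e' :
  @same_leaf (core_diagram i) e e' -> address e ~~> address e'.
Proof.
case: i e e' => [[P DP]|] e e' [i u v hi /= -> ->]; last exact: elinked_refl.
by have [f Hf [fP _]] := DP; apply: linked_eventually; exists f => //; exact: fP.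
Qed.

Lemma diagram_edge_address (i : option {P | D P}) (e : edge (two_trees (core_diagram i))) :
  diagram_address (diagram_edge e) ~~> address e.
Proof.
suff main a b : clos_refl_sym_trans _ (@same_leaf (core_diagram i)) a b ->
    address a ~~> address b by apply/main/clsP; exact: repK.
elim=> {a b} [a b|a|a b _|a b c _ + _].
- exact: same_leaf_linked.
- exact: elinked_refl.
- exact: elinked_sym.
- exact: elinked_trans.
Qed.

Definition cell_address (c : cell (core_diagrams D)) : seq bool :=
  match rep (tagged c) with inl u => sval u | inr v => sval v end.

Lemma cell_topP c : core_diagrams_address (top c) ~~> cell_address c.
Proof.
case: c => i c; rewrite /core_diagrams_address /cell_address /=.
by apply: elinked_trans (diagram_edge_address _) _; case: (rep c) => d; exact: elinked_refl.
Qed.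

Lemma cell_lbotP c : core_diagrams_address (lbot c) ~~> rcons (cell_address c) false.
Proof.
case: c => i c; rewrite /core_diagrams_address /cell_address /=.
by apply: elinked_trans (diagram_edge_address _) _; case: (rep c) => d; exact: elinked_refl.
Qed.

Lemma cell_rbotP c : core_diagrams_address (rbot c) ~~> rcons (cell_address c) true.
Proof.
case: c => i c; rewrite /core_diagrams_address /cell_address /=.
by apply: elinked_trans (diagram_edge_address _) _; case: (rep c) => d; exact: elinked_refl.
Qed.

Lemma base_address : core_diagrams_address (base_edge D) ~~> [::].
Proof. exact: diagram_edge_address. Qed.

(** Descending to a bottom edge appends a letter to both addresses; the
    folding that identifies top edges is the passage to parents. *)
Lemma fold_edge_linked e e' : fold_edge (@base_ident D) e e' ->
  core_diagrams_address e ~~> core_diagrams_address e'.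
Proof.
have congr2 u u' v v' : u ~~> u' -> v ~~> v' -> u ~~> v -> u' ~~> v'.
  move=> uu vv uv; apply: elinked_trans (elinked_sym uu) _.
  exact: elinked_trans uv vv.
have congr2' u u' v v' : u ~~> u' -> v ~~> v' -> u' ~~> v' -> u ~~> v.
  by move=> /elinked_sym uu /elinked_sym vv; exact: congr2.
elim=> {e e'} [e e' [i|i]|e|e e' _|e e' e'' _ + _|c c' _ IH|c c' _ IH|c c' _ IHl _ IHr].
- apply: elinked_trans base_address _; apply: elinked_sym.
  exact: diagram_edge_address.
- apply: elinked_trans base_address _; apply: elinked_sym.
  exact: diagram_edge_address.
- exact: elinked_refl.
- exact: elinked_sym.
- exact: elinked_trans.
- apply: congr2' (cell_lbotP c) (cell_lbotP c') _; apply: elinked_child.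
  exact: congr2 (cell_topP c) (cell_topP c') IH.
- apply: congr2' (cell_rbotP c) (cell_rbotP c') _; apply: elinked_child.
  exact: congr2 (cell_topP c) (cell_topP c') IH.
- apply: congr2' (cell_topP c) (cell_topP c') _; apply: elinked_parent.
  + exact: congr2 (cell_lbotP c) (cell_lbotP c') IHl.
  + exact: congr2 (cell_rbotP c) (cell_rbotP c') IHr.
Qed.

Lemma core_edge_address : core_address (core_edge D) ~~> [::].
Proof.
apply: elinked_trans base_address; apply: fold_edge_linked; exact: rep_folded_edge.
Qed.

Lemma core_cell_address (c : cell (core D)) : exists x, [/\ core_address (top c) ~~> x,
  core_address (lbot c) ~~> rcons x false & core_address (rbot c) ~~> rcons x true].
Proof.
exists (cell_address (rep c)); split.
- by apply: elinked_trans (cell_topP _); apply/fold_edge_linked/rep_folded_edge.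
- by apply: elinked_trans (cell_lbotP _); apply/fold_edge_linked/rep_folded_edge.
- by apply: elinked_trans (cell_rbotP _); apply/fold_edge_linked/rep_folded_edge.
Qed.

Lemma parent_inner T u b : rcons u b \in nodes T -> u \in inner_nodes T.
Proof.
elim: T u => [|l IHl r IHr] [|c u] //.
rewrite rcons_cons nodes_node => h; rewrite /= inE /= mem_cat; apply/orP.
by case: c h => /= [/IHr|/IHl] h; [right|left]; apply: map_f.
Qed.

(** A map from a tree to the core is determined by the image of the root,
    since the bottom edges of a cell of the core are determined, up to
    eventual linking, by its top edge. *)
Lemma tree_address T (E : edge (tree_complex T) -> edge (core D))
    (C : cell (tree_complex T) -> cell (core D)) :
  (forall c, top (C c) = E (top c)) -> (forall c, lbot (C c) = E (lbot c)) ->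
  (forall c, rbot (C c) = E (rbot c)) -> E (Defs.root T) = core_edge D ->
  forall e, core_address (E e) ~~> sval e.
Proof.
move=> Ct Cl Cr Er [u hu] /=; elim/last_ind: u hu => [|u b IH] hu.
  have -> : exist _ [::] hu = Defs.root T by exact: val_inj.
  by rewrite Er; exact: core_edge_address.
have iu := parent_inner hu; pose c : cell (tree_complex T) := exist _ u iu.
have [x [xt xl xr]] := core_cell_address (C c).
rewrite Ct in xt; rewrite Cl in xl; rewrite Cr in xr.
have xu : x ~~> u by apply: elinked_trans (elinked_sym xt) (IH _).
have : rcons x b ~~> rcons u b by exact: elinked_child.
apply: elinked_trans; case: b hu => hu.
- by have -> : exist _ (rcons u true) hu = rbot c by exact: val_inj.
- by have -> : exist _ (rcons u false) hu = lbot c by exact: val_inj.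
Qed.

Lemma accepts_leaves P : accepts (core_edge D) P ->
  forall i, (i < size (leaves (tplus P)))%N ->
  nth [::] (leaves (tplus P)) i ~~> nth [::] (leaves (tminus P)) i.
Proof.
move=> [phi [phit phib]] i hi.
have hi' : (i < size (leaves (tminus P)))%N by rewrite size_leaves.
have hu : nth [::] (leaves (tplus P)) i \in nodes (tplus P).
  by rewrite /nodes mem_cat mem_nth.
have hv : nth [::] (leaves (tminus P)) i \in nodes (tminus P).
  by rewrite /nodes mem_cat mem_nth.
have Hp e : core_address (mapE phi (diagram_edge (inl e))) ~~> sval e.
  move: e; apply: (@tree_address (tplus P) (fun e => mapE phi (diagram_edge (inl e)))
    (fun c => mapC phi (diagram_cell (inl c)))) => // c.
  - by rewrite map_top diagram_top.
  - by rewrite map_lbot diagram_lbot.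
  - by rewrite map_rbot diagram_rbot.
have Hm e : core_address (mapE phi (diagram_edge (inr e))) ~~> sval e.
  move: e; apply: (@tree_address (tminus P) (fun e => mapE phi (diagram_edge (inr e)))
    (fun c => mapC phi (diagram_cell (inr c)))) => // c.
  - by rewrite map_top diagram_top.
  - by rewrite map_lbot diagram_lbot.
  - by rewrite map_rbot diagram_rbot.
pose eu : edge (tree_complex (tplus P)) := exist (fun u => u \in nodes (tplus P)) _ hu.
pose ev : edge (tree_complex (tminus P)) := exist (fun v => v \in nodes (tminus P)) _ hv.
have euv : diagram_edge (inl eu) = diagram_edge (inr ev).
  by apply/clsP/rst_step; exact: (SameLeaf hi).
by apply: elinked_trans (elinked_sym (Hp eu)) _; rewrite euv; exact: Hm.
Qed.

Section Pieces.
Variable f : R -> R.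

Definition piecewise_at u :=
  piecewise_in H f (binary R u) (binary R u + 1 / 2 ^+ size u).

Lemma piecewise_at_join u : piecewise_at (rcons u false) ->
  piecewise_at (rcons u true) -> piecewise_at u.
Proof.
have p0 := pow2n_gt0 R (size u).
rewrite /piecewise_at !binary_rcons !size_rcons mul0r addr0 => h0 h1.
have e2 : (1 : R) / 2 ^+ (size u).+1 = 1 / 2 ^+ size u / 2.
  by rewrite exprS; field; rewrite pow2n_neq0.
have q0 : 0 < 1 / (2 : R) ^+ size u by rewrite divr_gt0.
apply: (@piecewise_cut _ _ _ _ (binary R u + 1 / 2 ^+ (size u).+1)) => //.
- by have := binary_dyadic R (rcons u true); rewrite binary_rcons.
- by rewrite e2; lra.
- by rewrite e2; lra.
- move: h1; congr (piecewise_in H f _ _); rewrite ?e2 //; by field; rewrite pow2n_neq0.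
Qed.

Lemma piecewise_at_bar k u : (forall w, size w = k -> piecewise_at (u ++ w)) ->
  piecewise_at u.
Proof.
elim: k u => [|k IH] u h; first by rewrite -[u]cats0; exact: h.
by apply: piecewise_at_join; apply: IH => w sw; rewrite cat_rcons; apply: h; rewrite /= sw.
Qed.

Lemma piecewise_at_tree T u : (forall w, w \in leaves T -> piecewise_at (u ++ w)) ->
  piecewise_at u.
Proof.
elim: T u => [|l IHl r IHr] u h; first by rewrite -[u]cats0; apply: h; rewrite inE.
apply: piecewise_at_join.
- by apply: IHl => w hw; rewrite cat_rcons; apply: h; rewrite mem_cat map_f.
- by apply: IHr => w hw; rewrite cat_rcons; apply: h; rewrite mem_cat map_f ?orbT.
Qed.

End Pieces.

(** The two leaves of number i have the same image in the core, so both are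
    eventually linked to its address; on the pieces of the leaf provided by
    the linking, f coincides with elements of H since both are linear with the
    same endpoints. *)
Lemma closure_piecewise f : Cl H f -> piecewise_in H f 0 1.
Proof.
move=> [P [fP _] acc].
have : piecewise_at f [::].
  apply: (@piecewise_at_tree f (tplus P)) => w /(nthP [::])[i hi <-] /=.
  have [k kP] := accepts_leaves acc hi.
  apply: (@piecewise_at_bar f k) => w' /kP[h Hh hw'].
  apply: piecewise_piece Hh _.
  by apply: maps_linearly_eq hw'; apply: maps_linearly_cat; exact: fP.
by rewrite /piecewise_at /= add0r expr0 divr1.
Qed.

End CoreAddresses.

(** * Trees of minimal words *)

Section MinimalTrees.
Implicit Types (p : pred (seq bool)) (u v w x y : seq bool).

(** The bound [n] is fuel: when all words of length [n] satisfy [p], the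
    leaves are the minimal words satisfying [p]. *)
Fixpoint minimal_tree n p : tree :=
  if n is n'.+1 then
    if p [::] then Leaf
    else Node (minimal_tree n' (fun u => p (false :: u)))
              (minimal_tree n' (fun u => p (true :: u)))
  else Leaf.

Lemma mem_leaves_node l r b u :
  (b :: u \in leaves (Node l r)) = (u \in leaves (if b then r else l)).
Proof.
rewrite /= mem_cat.
have inj c : injective (cons c : seq bool -> seq bool) by move=> x y [].
have no c s : b != c -> (b :: u \in [seq (c :: v) | v <- s]) = false.
  by move=> bc; apply/mapP => -[v _ [E _]]; rewrite E eqxx in bc.
by case: b no => no; [rewrite (no false)|rewrite (no true)]; rewrite // ?orbF mem_map.
Qed.

Lemma nil_leaves_node l r : ([::] \in leaves (Node l r)) = false.
Proof. by rewrite /= mem_cat; apply/orP => -[] /mapP[]. Qed.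

Lemma minimal_treeP n p u : (forall w, size w = n -> p w) ->
  u \in leaves (minimal_tree n p) <->
  p u /\ forall x y, u = x ++ y -> y <> [::] -> ~~ p x.
Proof.
elim: n p u => [|n IH] p u pn.
  rewrite /= inE; split=> [/eqP->|[_ h]].
    by split; [exact: pn|move=> -[|//] -[|//] _ /(_ erefl)].
  case: u h => // b u /(_ [::] (b :: u) erefl); rewrite pn // => h.
    by have := h ltac:(by []).
rewrite /=; case: ifPn => p0.
  rewrite inE; split=> [/eqP->|[_ h]]; first by split => // -[|//] -[|//] _ /(_ erefl).
  case: u h => // b u /(_ [::] (b :: u) erefl); rewrite p0 => h.
  by have := h ltac:(by []).
case: u => [|b u].
  by rewrite nil_leaves_node; split=> // -[pn0 _]; rewrite pn0 in p0.
have -> : (b :: u \in leaves (Node (minimal_tree n (fun u => p (false :: u)))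
      (minimal_tree n (fun u => p (true :: u))))) =
    (u \in leaves (minimal_tree n (fun u => p (b :: u)))).
  by rewrite mem_leaves_node; case: b.
rewrite (IH (fun u => p (b :: u))); last by move=> w sw; apply: pn; rewrite /= sw.
split=> -[pu h]; split => //.
- by move=> [|c x] y //= [<- uE]; exact: h uE.
- by move=> x y E; apply: (h (b :: x) y); rewrite E.
Qed.

(** Finitely many words of length n, handled by recursion on their letters,
    give a uniform bound. *)
Lemma bar_uniform (p : seq bool -> Prop) n :
  (forall u w, p u -> p (u ++ w)) ->
  (forall u, size u = n -> exists k, forall w, size w = k -> p (u ++ w)) ->
  exists m, forall u, size u = m -> p u.
Proof.
elim: n p => [|n IH] p pcat h; first exact: (h [::]).
have hb b : exists m, forall u, size u = m -> p (b :: u).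
  apply: IH => [u w|u su]; first exact: (pcat (b :: u)).
  by have [|k hk] := h (b :: u); [rewrite /= su|exists k].
have [m0 h0] := hb false; have [m1 h1] := hb true.
exists (maxn m0 m1).+1 => -[//|b u] [su].
have [m [hm mu]] : exists m, (forall u, size u = m -> p (b :: u)) /\ (m <= size u)%N.
  by case: b; [exists m1|exists m0]; rewrite su ?leq_maxl ?leq_maxr.
rewrite -(cat_take_drop m u) -cat_cons; apply/pcat/hm.
by rewrite size_take_min; apply/minn_idPl.
Qed.

End MinimalTrees.

(** * Reduced tree pairs *)

Section ReducedPairs.
Variable R : realType.
Implicit Types (t : R) (u v w x y : seq bool) (f g h : thompson R).

Lemma binary_lt1 u : binary R u < 1.
Proof. by apply: lt_le_trans (binary_le1 R u); rewrite ltrDl divr_gt0 ?pow2n_gt0. Qed.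

Lemma binary_inj u v : size u = size v -> binary R u = binary R v -> u = v.
Proof.
elim: u v => [|b u IH] [|c v] //= [suv] E.
have {}E : b%:R + binary R u = c%:R + binary R v by move: E; lra.
have bu := binary_lt1 u; have bv := binary_lt1 v.
have bu0 := binary_ge0 R u; have bv0 := binary_ge0 R v.
have bc : b = c by case: b c E {IH} => -[] //=; lra.
by rewrite -bc in E *; rewrite (IH v) //; apply: (addrI b%:R).
Qed.

Lemma binary_numerator u : exists m : int, binary R u = m%:~R / 2 ^+ size u.
Proof.
elim: u => [|b u [m IH]] /=; first by exists 0; rewrite mul0r.
exists (b%:Z * 2 ^+ size u + m).
rewrite IH exprS rmorphD rmorphM rmorphXn /=; field; exact: pow2n_neq0.
Qed.

Lemma binary_surj n (m : int) : 0 <= (m%:~R : R) / 2 ^+ n < 1 ->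
  exists2 u, size u = n & binary R u = m%:~R / 2 ^+ n.
Proof.
elim: n m => [|n IH] m.
  rewrite expr0 divr1 ler0z ltrz1 => /andP[m0 m1]; exists [::] => //=.
  by have -> : m = 0 by lia.
move=> /andP[m0 m1]; have p0 := pow2n_gt0 R n.
have E c : (m - c * 2 ^+ n)%:~R / 2 ^+ n = 2 * (m%:~R / 2 ^+ n.+1) - c%:~R :> R.
  by rewrite exprS rmorphB rmorphM rmorphXn /=; field; rewrite pow2n_neq0.
have [m2|m2] := ltP ((m%:~R : R) / 2 ^+ n.+1) (1 / 2).
  have [|u su bu] := IH (m - 0 * 2 ^+ n).
    by rewrite E mulr0z; move: m0 m1 m2; move: (m%:~R / _) => q q0 q1 q2; apply/andP; split; lra.
  exists (false :: u); first by rewrite /= su.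
  by rewrite /= bu E mulr0z; field; rewrite ?pow2n_neq0.
have [|u su bu] := IH (m - 1 * 2 ^+ n).
  by rewrite E mulr1z; move: m0 m1 m2; move: (m%:~R / _) => q q0 q1 q2; apply/andP; split; lra.
exists (true :: u); first by rewrite /= su.
by rewrite /= bu E mulr1z; field; rewrite ?pow2n_neq0.
Qed.

Lemma common_denominator (B : seq R) : {in B, forall c, dyadic c} ->
  exists n, {in B, forall c, exists m : int, c = m%:~R / 2 ^+ n}.
Proof.
elim: B => [|c B IH] BD; first by exists 0%N.
have [n hn] := IH (fun b bB => BD b (ltac:(by rewrite inE bB orbT))).
have [m [k ck]] := BD c (mem_head c B).
exists (n + k)%N => b; rewrite inE => /predU1P[->|/hn[l ->]].
- by exists (m * 2 ^+ n); rewrite ck rmorphM rmorphXn /= exprD; field; rewrite !pow2n_neq0.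
- by exists (l * 2 ^+ k); rewrite rmorphM rmorphXn /= exprD; field; rewrite !pow2n_neq0.
Qed.

Definition standard f u : bool := `[< exists v, maps_linearly f u v >].

Lemma standard_cat f u w : standard f u -> standard f (u ++ w).
Proof.
by move=> /asboolP[v fv]; apply/asboolP; exists (v ++ w); exact: maps_linearly_cat.
Qed.

(** Between two break points f is affine with slope a power of 2; a
    subinterval is mapped onto a standard interval as soon as its image is so
    short that the left end of the image is a multiple of its length. *)
Lemma eventually_standard f : exists n, forall u, size u = n -> standard f u.
Proof.
have [B BD fB] := thompson_pl f; have [n hn] := common_denominator BD.
apply: (@bar_uniform (standard f) n) => [u w|u su]; first exact: standard_cat.
have p0 := pow2n_gt0 R (size u).
have [mu bu] := binary_numerator u.
pose b1 := binary R u + 1 / 2 ^+ size u.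
have ub1 : binary R u < b1 by rewrite ltrDl divr_gt0.
have [|k fk] := fB _ _ (binary_ge0 R u) ub1 (binary_le1 R u).
  move=> c /hn[m ->]; rewrite /b1 bu -mulrDl -su !ltr_pM2r ?invr_gt0 //.
  have -> : mu%:~R + 1 = (mu + 1)%:~R :> R by rewrite intrD.
  by rewrite !ltr_int; lia.
have [a [b eab]] : exists a b : nat, (2 : R) ^ k = 2 ^+ a / 2 ^+ b.
  case: k {fk} => k; first by exists k, 0%N; rewrite expr0 divr1.
  by exists 0%N, k.+1; rewrite NegzE expr0 div1r exprnN.
have [m [N fu]] := thompson_dyadic f (binary_dyadic R u).
exists (N + a)%N => w sw; apply/asboolP.
have [i bw] := binary_numerator w.
have sE : binary R (u ++ w) = binary R u + binary R w / 2 ^+ size u by exact: binary_cat.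
have img t : 0 <= t <= 1 -> f (binary R (u ++ w) + t / 2 ^+ size (u ++ w)) =
    (m * 2 ^+ (b + size u) + i)%:~R / 2 ^+ (b + size u + N) + t / 2 ^+ (b + size u + N).
  move=> /andP[t0 t1].
  have hq : 0 <= binary R w + t / 2 ^+ size w <= 1.
    rewrite addr_ge0 ?binary_ge0 ?divr_ge0 ?exprn_ge0 //=.
    by apply: le_trans (binary_le1 R w); rewrite lerD2l ler_pM2r ?invr_gt0 ?pow2n_gt0.
  have E : binary R (u ++ w) + t / 2 ^+ size (u ++ w) =
      binary R u + (binary R w + t / 2 ^+ size w) / 2 ^+ size u.
    by rewrite sE size_cat exprD; field; rewrite !pow2n_neq0.
  rewrite E fk; last first.
    case/andP: hq => q0 q1; rewrite lerDl divr_ge0 ?(ltW p0) //=.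
    by rewrite /b1 lerD2l ler_pM2r ?invr_gt0.
  rewrite fu eab bw sw !exprD rmorphD !rmorphM !rmorphXn /=.
  by field; rewrite !pow2n_neq0.
have e01 : 0 <= (0 : R) <= 1 by apply/andP; split.
have img0 := img 0 e01; rewrite !mul0r !addr0 in img0.
have [|v sv bv] := @binary_surj (b + size u + N) (m * 2 ^+ (b + size u) + i).
  rewrite -img0 thompson_lt1 binary_lt1 andbT -(thompson0 f) thompson_le.
  exact: binary_ge0.
by exists v => t t01; rewrite img // sv bv.
Qed.

Lemma maps_linearly_inj f u v v' : maps_linearly f u v -> maps_linearly f u v' -> v = v'.
Proof.
move=> h h'.
have e01 : 0 <= (0 : R) <= 1 by apply/andP; split.
have e11 : 0 <= (1 : R) <= 1 by apply/andP; split.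
have := h' 0 e01; rewrite h // !mul0r !addr0 => b0.
have := h' 1 e11; rewrite h // b0 => /addrI; rewrite !div1r => /invr_inj E.
apply: binary_inj => //.
by apply: (@ieexprIn R 2) E => //; rewrite eq_sym lt_eqF // ltr1n.
Qed.

Lemma standard_image f u : standard f u ->
  exists2 v, maps_linearly f u v & standard (f^-1)%g v.
Proof.
move=> /asboolP[v fv]; exists v => //; apply/asboolP; exists u.
exact: maps_linearly_can (thompson_invK f) fv.
Qed.

(** A standard interval for the inverse that properly contained [v] would have
    a standard image properly containing [u]. *)
Lemma minimal_image f u v : maps_linearly f u v ->
  (forall x y, u = x ++ y -> y <> [::] -> ~~ standard f x) ->
  forall x y, v = x ++ y -> y <> [::] -> ~~ standard (f^-1)%g x.
Proof.
move=> fuv umin x y vE y0; apply/negP => /asboolP[z gz].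
have gv := maps_linearly_can (thompson_invK f) fuv.
have := maps_linearly_cat y gz; rewrite -vE => /(maps_linearly_inj gv) uE.
have /negP := umin z y uE y0; apply; apply/asboolP; exists x.
exact: maps_linearly_can (thompson_Kinv f) gz.
Qed.

Definition word_lt u v := binary R u < binary R v.

Lemma leaves_sorted T : sorted word_lt (leaves T).
Proof.
have tr : transitive word_lt by move=> ? ? ?; exact: lt_trans.
rewrite (sorted_pairwise tr); elim: T => //= l IHl r IHr.
rewrite pairwise_cat !pairwise_map; apply/and3P; split.
- apply/allrelP => _ _ /mapP[u _ ->] /mapP[v _ ->]; rewrite /word_lt /=.
  by have := binary_lt1 u; have := binary_ge0 R v; lra.
- by apply: sub_pairwise IHl => u v; rewrite /word_lt /=; lra.
- by apply: sub_pairwise IHr => u v; rewrite /word_lt /=; lra.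
Qed.

Lemma maps_linearly_join f u v : maps_linearly f (rcons u false) (rcons v false) ->
  maps_linearly f (rcons u true) (rcons v true) -> maps_linearly f u v.
Proof.
move=> h0 h1 t /andP[t0 t1].
have E (w : seq bool) (b : bool) : binary R w + t / 2 ^+ size w =
    binary R (rcons w b) + (2 * t - b%:R) / 2 ^+ size (rcons w b).
  by rewrite binary_rcons size_rcons exprS; field; rewrite pow2n_neq0.
have [t2|t2] := leP t (1 / 2).
- by rewrite !(E _ false) h0 //; rewrite subr0; lra.
- by rewrite !(E _ true) h1 //=; lra.
Qed.

(** The leaves of the two trees are the minimal words that f, respectively its
    inverse, maps linearly onto a standard interval. The bijection between
    them respects the order, so leaves correspond by number. If two
    consecutive leaves formed a caret on both sides, f would be linear on
    their parent, against minimality. *)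
Lemma reduced_pair_exists f : exists P, reduced_pair_of f P.
Proof.
have [n hn] := eventually_standard f; have [n' hn'] := eventually_standard (f^-1)%g.
pose Tp := minimal_tree n (standard f); pose Tm := minimal_tree n' (standard (f^-1)%g).
have /choice[phi phiP] : forall u, exists v, standard f u -> maps_linearly f u v.
  move=> u; case: (boolP (standard f u)) => [/asboolP[v fv]|_]; first by exists v.
  by exists [::].
have leafP u : u \in leaves Tp -> maps_linearly f u (phi u).
  by move=> /(minimal_treeP _ hn)[/phiP].
have imE u : u \in leaves Tp -> binary R (phi u) = f (binary R u).
  move=> /leafP/(_ 0); rewrite !mul0r !addr0 => -> //.
  by apply/andP; split.
have Tmem : [seq phi u | u <- leaves Tp] =i leaves Tm.
  move=> v; apply/mapP/idP => [[u uT ->]|/(minimal_treeP _ hn')[gv vmin]].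
    apply/(minimal_treeP _ hn'); have [_ umin] := (minimal_treeP u hn).1 uT.
    split; last exact: minimal_image (leafP u uT) umin.
    apply/asboolP; exists u; exact: maps_linearly_can (thompson_invK f) (leafP u uT).
  have [u gvu fu] := standard_image gv; rewrite invgK in fu.
  have uT : u \in leaves Tp.
    apply/(minimal_treeP _ hn); split=> //.
    by have := minimal_image gvu vmin; rewrite invgK.
  exists u => //; apply: (maps_linearly_inj _ (leafP u uT)).
  exact: maps_linearly_can (thompson_Kinv f) gvu.
have Tsort : sorted word_lt [seq phi u | u <- leaves Tp].
  apply: (homo_sorted_in (e := word_lt) (P := [in leaves Tp])) (leaves_sorted Tp).
    by move=> u v uT vT; rewrite /word_lt !imE // thompson_lt.
  exact/allP.
have Teq : leaves Tm = [seq phi u | u <- leaves Tp].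
  apply/esym/(irr_sorted_eq (leT := word_lt)) => //; last exact: leaves_sorted.
  - by move=> ? ? ?; exact: lt_trans.
  - by move=> u; exact: ltxx.
have sz : size (leaves Tm) = size (leaves Tp) by rewrite Teq size_map.
exists (TreePair sz); split=> /= [i hi|i [[x [x0 x1]] [y [y0 y1]]]].
  by rewrite Teq (nth_map [::]) //; apply/leafP/mem_nth.
have hi1 : (i.+1 < size (leaves Tp))%N.
  rewrite ltnNge; apply/negP => h; rewrite nth_default // in x1.
  by case: (x) x1.
have hi := ltnW hi1.
have [_ umin] := (minimal_treeP _ hn).1 (mem_nth [::] hi).
have /negP := umin x [:: false] (ltac:(by rewrite cats1)) ltac:(by []); apply.
apply/asboolP; exists y; apply: maps_linearly_join.
- rewrite -x0 -y0 Teq (nth_map [::]) //; exact/leafP/mem_nth.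
- rewrite -x1 -y1 Teq (nth_map [::]) //; exact/leafP/mem_nth.
Qed.

End ReducedPairs.

(** * The subgroup lies in its closure *)

Section Inclusion.
Variables (D : set tree_pair) (P : tree_pair) (DP : D P).

Let i : option {P | D P} := Some (exist _ P DP).

(** The inclusion into the disjoint union followed by the folding map. *)
Lemma core_accepts : accepts (core_edge D) P.
Proof.
pose r := @base_ident D.
pose V (x : vertex (diagram P)) : vertex (core D) :=
  to_folded_vertex r (existT (fun i => vertex (diagram (core_diagram i))) i x).
pose E (x : edge (diagram P)) : edge (core D) :=
  to_folded_edge r (existT (fun i => edge (diagram (core_diagram i))) i x).
pose C (x : cell (diagram P)) : cell (core D) :=
  to_folded_cell r (existT (fun i => cell (diagram (core_diagram i))) i x).
have Ei x : ini (E x) = V (ini x) by exact: folded_ini.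
have Et x : ter (E x) = V (ter x) by exact: folded_ter.
have Ct x : top (C x) = E (top x) by exact: folded_top.
have Cl x : lbot (C x) = E (lbot x) by exact: folded_lbot.
have Cr x : rbot (C x) = E (rbot x) by exact: folded_rbot.
exists (Morphism Ei Et Ct Cl Cr); split; apply/to_folded_edgeP/fold_sym/fold_base.
- exact: (BaseTop i).
- exact: (BaseBottom i).
Qed.

End Inclusion.

Lemma sub_closure (R : realType) (H : set (thompson R)) : H `<=` Cl H.
Proof.
move=> f Hf; have [P fP] := reduced_pair_exists f.
by exists P => //; apply: core_accepts; exists f.
Qed.

Theorem corollary1p4 (R : realType) (H : set (thompson R)) (subH : is_subgroup H) :
  H = setT <->
  [/\ commutator_subgroup (thompson R) `<=` Cl H,
      set_mulg H (commutator_subgroup (thompson R)) = setT &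
      exists h : thompson R, H h /\ exists a : R,
        [/\ inner_dyadic a, h a = a, left_slope h a 1 & right_slope h a 2]].
Proof.
have [b [bL bR bmoves]] := thompson_bump R.
split=> [HT|[HCl HC [p [Hp [al [ial pal pL pR]]]]]].
  have Hall f : H f by rewrite HT.
  split.
  - by move=> f _; apply: sub_closure.
  - apply/seteqP; split => // f _; exists f => //; exists 1%g; last exact: mulg1.
    by move=> A [sA _]; exact: subgroup_1.
  - exists b; split => //; exists (1 / 2); split.
    + split; last by apply/andP; split; lra.
      by rewrite div1r -exprN1; exact: dyadic_pow2.
    + by apply: bL => /=.
    + rewrite -(expr0z 2); apply: germ_left_slope.
      exists 1 => // t /andP[t0 _]; rewrite expr0z mulr1.
      have tb : 1 / 2 + -1 * t <= 1 / 2 :> R by lra.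
      by rewrite (bL _ tb) (bL _ (lexx _)).
    + by rewrite -[2](expr1z 2); apply: germ_right_slope.
have [a Ha [c Cc ac]] : set_mulg H (commutator_subgroup (thompson R)) b by rewrite HC.
(* b = a c with a in H and c in [F,F], so a acts as b near 0 and near 1 *)
have [c0 [c1 [c00 c11 cL cR]]] := commutator_compactly_supported Cc.
have aE t : a t = b ((c^-1)%g t) by rewrite -ac !thompson_mulE thompson_Kinv.
pose v := Num.max (3 / 4) c1.
have av t : v < t < 1 -> a t <> t.
  rewrite gt_max => /andP[/andP[t34 tc] t1].
  have ct : (c^-1 t)%g = t by apply: fixed_point_inv; apply: cR; exact: ltW.
  by rewrite aE ct; apply: bmoves; rewrite ltW.
have v1 : v < 1 by rewrite gt_max c11 andbT; lra.
pose m := (v + 1) / 2.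
have am : a m <> m by apply: av; rewrite /m; lra.
have aL : fixes_below a (Num.min (1 / 2) c0).
  move=> t /=; rewrite le_min => /andP[t2 tc].
  by rewrite aE fixed_point_inv; [exact: bL|exact: cL].
have m0 : 0 < Num.min (1 / 2) c0 by rewrite lt_min c00 andbT; lra.
have [e [u [ie eu ae au]]] := first_moved m0 aL am.
have [_ /andP[al0 al1]] := ial.
apply: (generation subH _ Ha ie eu ae au v1 av Hp ial pal _ _ HC).
- by move=> f /HCl; exact: closure_piecewise.
- by apply: left_slope_germ; rewrite ?ltW // expr0z.
- by apply: right_slope_germ; rewrite ?ltW // expr1z.
Qed.
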